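(* Let $n\ge2$, let $f\in\mathbb{R}[x_1,\dots,x_n]$ be a form of degree $n$ in $n$ variables, and let $\mathcal{Z}$ be a nonempty $\mathrm{SL}_n(\mathbb{Z})$-invariant subset of $\mathbb{Z}^n\setminus\{\vec 0\}$. Suppose that: (i) $f(\mathcal{Z})$ is discrete in $\mathbb{R}$; (ii) $f$ does not represent $0$ over $\mathbb{Q}$ non-trivially; (iii) $f$ is not totally imaginary (which, in particular, is satisfied if $n$ is odd). Then $f$ is a norm form.
   Context: A form of degree $n$ in $n$ variables is a homogeneous polynomial $f(\vec x)\in\mathbb{R}[\vec x]$, $\vec x=(x_1,\dots,x_n)$, which factors as $f=l_1\cdots l_n$ with $l_1,\dots,l_n$ linear forms with complex coefficients, linearly independent over $\mathbb{C}$. Up to scaling the factors, the $l_i$ consist of $s$ pairs of complex-conjugate (non-real) linear forms and $t$ real linear forms, $n=2s+t$; $f$ is totally imaginary if $t=0$. $f$ represents $0$ over $\mathbb{Q}$ non-trivially if $f(\vec v)=0$ for some $\vec v\in\mathbb{Q}^n\setminus\{\vec 0\}$. A subset of $\mathbb{R}$ is discrete in $\mathbb{R}$ if it has no accumulation point in $\mathbb{R}$. $\mathrm{SL}_n(\mathbb{R})$ acts on $\mathbb{R}[\vec x]$ by $(gp)(\vec x)=p(g^{-1}\vec x)$; forms $f$ and $gf$ with $g\in\mathrm{SL}_n(\mathbb{Q})$ are called $\mathbb{Q}$-equivalent. Norm form: let $K=\mathbb{Q}\alpha_1+\dots+\mathbb{Q}\alpha_n$ be a number field of degree $n$ and $\theta_1,\dots,\theta_n$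 all the embeddings of $K$ into $\mathbb{C}$. Put $l_i(\vec x)=\theta_i(\alpha_1)x_1+\dots+\theta_i(\alpha_n)x_n$ and $\mathfrak{N}_K(\vec x)=\prod_{i=1}^n l_i(\vec x)$. A norm form (corresponding to $K$) is a form $\mathbb{Q}$-equivalent to $c\cdot\mathfrak{N}_K(\vec x)$ for some $c\in\mathbb{R}^*$. *)

(* Defs.v *)
From HB Require Import structures.
From mathcomp Require Import all_boot all_order all_algebra all_field.
(* mpoly has to be imported before classical_sets: in the other order their
   notations are incompatible. *)
From mathcomp Require Import mpoly complex.
From mathcomp Require Import boolp classical_sets reals topology normedtype.

Set Implicit Arguments.
Unset Strict Implicit.
Unset Printing Implicit Defensive.

Import Order.TTheory GRing.Theory Num.Theory.
Import numFieldNormedType.Exports.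

Local Open Scope ring_scope.

Definition linear_form (n : nat) (F : nzRingType) (l : 'rV[F]_n) : {mpoly F[n]} :=
  \sum_(j < n) l 0 j *: 'X_j.

Definition complex_mpoly (R : realType) (n : nat) (p : {mpoly R[n]}) :
  {mpoly R[i][n]} := map_mpoly (real_complex R) p.

Definition factors_as (R : realType) (n : nat) (f : {mpoly R[n]})
    (L : 'M[R[i]]_n) : Prop :=
  row_free L /\ complex_mpoly f = \prod_(i < n) linear_form (row i L).

Definition is_form (R : realType) (n : nat) (f : {mpoly R[n]}) : Prop :=
  f \is n.-homog /\ exists L, factors_as f L.

Definition real_up_to_scaling (R : realType) (n : nat) (l : 'rV[R[i]]_n) :
  Prop := exists2 c : R[i], c != 0 &
    exists m : 'rV[R]_n, c *: l = map_mx (real_complex R) m.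

(* The number t in n = 2 s + t: the other factors, not proportional to real
   forms, come up to scaling in s complex-conjugate pairs. *)
Definition num_real_factors (R : realType) (n : nat) (L : 'M[R[i]]_n) : nat :=
  #|[set i : 'I_n | `[< real_up_to_scaling (row i L) >]]|.

(* Factorizations are unique up to order and scaling of the factors, so the
   choice of L does not matter. *)
Definition totally_imaginary (R : realType) (n : nat) (f : {mpoly R[n]}) : Prop :=
  exists2 L, factors_as f L & num_real_factors L = 0%N.

Definition represents_zero_over_Q (R : realType) (n : nat) (f : {mpoly R[n]}) :
  Prop := exists2 v : 'cV[rat]_n, v != 0 &
    f.@[fun j => ratr (v j 0)] = 0.

Definition int_values (R : realType) (n : nat) (f : {mpoly R[n]})
    (Z : set 'cV[int]_n) : set R :=
  [set f.@[fun j => (z j 0)%:~R] | z in Z]%classic.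

Definition discrete_in_R (R : realType) (A : set R) : Prop :=
  limit_point A = set0.

Definition SLZ_invariant (n : nat) (Z : set 'cV[int]_n) : Prop :=
  forall g : 'M[int]_n, \det g = 1 -> forall z, Z z -> Z (g *m z).

(* (g p)(x) = p (g^-1 x) *)
Definition mx_act (n : nat) (F : comUnitRingType) (g : 'M[F]_n)
    (p : {mpoly F[n]}) : {mpoly F[n]} :=
  p \mPo [tuple linear_form (row i (invmx g)) | i < n].

Definition Q_equivalent (R : realType) (n : nat) (f h : {mpoly R[n]}) : Prop :=
  exists2 g : 'M[rat]_n, \det g = 1 & h = mx_act (map_mx ratr g) f.

Definition all_embeddings (R : realType) (n : nat) (K : fieldExtType rat)
    (theta : 'I_n -> {rmorphism K -> R[i]}) : Prop :=
  (forall i j, theta i =1 theta j -> i = j) /\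
  (forall phi : {rmorphism K -> R[i]}, exists i, theta i =1 phi).

(* A polynomial over R[i]; its coefficients are in fact rational. *)
Definition field_norm_form (R : realType) (n : nat) (K : fieldExtType rat)
    (theta : 'I_n -> {rmorphism K -> R[i]}) (alpha : n.-tuple K) :
  {mpoly R[i][n]} :=
  \prod_(i < n) linear_form (\row_j theta i (tnth alpha j)).

Definition norm_form (R : realType) (n : nat) (f : {mpoly R[n]}) : Prop :=
  exists (K : fieldExtType rat) (alpha : n.-tuple K)
    (theta : 'I_n -> {rmorphism K -> R[i]}) (c : R) (p : {mpoly R[n]}),
    [/\ \dim {:K} = n, basis_of {:K} alpha, all_embeddings theta, c != 0 &
      complex_mpoly p = real_complex R c *: field_norm_form theta alpha /\
      Q_equivalent p f].

(* Main.v *)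
Require Import Defs.
From HB Require Import structures.
From mathcomp Require Import all_boot all_order all_algebra all_field.
From mathcomp Require Import ring lra zify.
From mathcomp Require Import mpoly complex.
From mathcomp Require Import boolp classical_sets cardinality reals topology.
From mathcomp Require Import normedtype sequences.

Set Implicit Arguments.
Unset Strict Implicit.
Unset Printing Implicit Defensive.

Import Order.TTheory GRing.Theory Num.Theory.
Import numFieldNormedType.Exports.

Local Open Scope ring_scope.

(* Write [f = l_1 ... l_n]. A matrix [g] in [M_n(Q)] with [l_i o g = lam_i l_i] for
   all [i] exhibits [f] as a norm form as soon as one [lam_i0] is simple: as [f]
   has no rational zero, a rational polynomial vanishing at one [lam_i] vanishes
   at all of them, so the characteristic polynomial of [g] is irreducible, and
   the [l_i] are, up to scalars, the conjugates of a linear form over the field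
   [Q[g]].

   Such a [g] comes from a Dirichlet-type argument. By transitivity of [SL_n(Z)]
   on primitive vectors, [f] is bounded away from 0 on [Z^n \ 0] and has finitely
   many values in every bounded interval. Let [l_i0] be a real factor. For every
   [Q] a pigeonhole argument yields a basis [B_Q] of a sublattice of [Z^n] of
   vectors of size O(Q) on which [l_i0] is O(Q^(1-n)); the other factors are then
   O(Q), so [f o B_Q] is bounded and takes only finitely many values on a finite
   grid of points, hence runs through finitely many polynomials. When
   [f o B_Q = f o B_Q'], the forms [l_i o B_Q] and [l_i o B_Q'] agree up to order
   and scalars; fixing also the permutation, [g = B_Q' B_Q^-1] has the [l_i] as
   eigenvectors, with [lam_i0] small and the others large when [Q' / Q] is large. *)

(** * Linear forms and integer vectors *)

Lemma spanning_subfamily_or_hyperplane (F : fieldType) (n : nat) (T : finType)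
    (w : T -> 'rV[F]_n) :
  (exists s : 'I_n -> T, \matrix_(i < n) w (s i) \in unitmx) \/
  (exists2 h : 'cV[F]_n, h != 0 & forall t, w t *m h = 0).
Proof.
pose A := \matrix_(k < #|T|) w (enum_val k).
have [fA|nfA] := boolP (row_full A).
  left; exists (fun i => enum_val (fullrankfun fA i)).
  rewrite -row_full_unit.
  suff -> : \matrix_(i < n) w (enum_val (fullrankfun fA i)) =
            rowsub (fullrankfun fA) A by apply: fullrowsub_full.
  by apply/row_matrixP => i; rewrite rowK row_rowsub rowK.
right.
have : kermx A^T != 0.
  by rewrite kermx_eq0 -[row_free _]/(\rank A^T == n) mxrank_tr.
case/rowV0Pn=> u /sub_kermxP uA u0; exists u^T.
  by rewrite -(inj_eq (@trmx_inj _ _ _)) trmxK trmx0.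
move=> t; have := congr1 (row (enum_rank t)) (congr1 trmx uA).
by rewrite trmx_mul trmxK row_mul rowK enum_rankK => ->; rewrite trmx0 row0.
Qed.

(* If a row of [L1 L2^-1] had two nonzero entries, one could choose [z] with
   all coordinates nonzero and killed by that row. *)
Lemma eq_prod_linear_forms (F : numFieldType) (n : nat) (L1 L2 : 'M[F]_n) :
  L2 \in unitmx ->
  (forall y : 'cV[F]_n,
     \prod_i (L1 *m y) i 0 = \prod_i (L2 *m y) i 0) ->
  forall i, exists j, exists2 c, c != 0 & row i L1 = c *: row j L2.
Proof.
move=> uL2 eqL i.
have [A LA] : exists A, L1 = A *m L2 by exists (L1 *m invmx L2); rewrite mulmxKV.
have eqA (z : 'cV[F]_n) : \prod_i (A *m z) i 0 = \prod_i z i 0.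
  have := eqL (invmx L2 *m z).
  by rewrite LA -!mulmxA mulKVmx.
have nzA : exists j, A i j != 0.
  apply/existsP; apply: contraT => /existsPn A0.
  have := eqA (const_mx 1); rewrite [RHS]big1 => [|j _]; last by rewrite mxE.
  rewrite (bigD1 i) //= mxE big1 => [|j _].
    by rewrite mul0r => /esym/eqP; rewrite oner_eq0.
  by have /negPn/eqP-> := A0 j; rewrite mul0r.
have [j Aij] := nzA; exists j, (A i j) => //.
have Aik k : k != j -> A i k = 0.
  move=> kj; apply/eqP/negPn/negP => Aik.
  pose s := \sum_(q | (q != j) && (q != k)) A i q.
  have [b b0 sb] : exists2 b, b != 0 & s + A i k * b != 0.
    have [s1|] := eqVneq (s + A i k * 1) 0; last by exists 1; rewrite ?oner_eq0.
    exists 2%:R; first by rewrite pnatr_eq0.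
    by rewrite mulr_natr mulr2n addrA -[X in s + X]mulr1 s1 add0r.
  pose a := - (s + A i k * b) / A i j.
  pose z : 'cV[F]_n := \col_q (if q == j then a else if q == k then b else 1).
  have := eqA z; rewrite (bigD1 i) //= [X in X * _ = _]mxE (bigD1 j) //=.
  rewrite (bigD1 k) //= !mxE !eqxx (negPf kj).
  rewrite [X in _ + (_ + X)](eq_bigr (fun q => A i q)); last first.
    by move=> q /andP[/negPf qj /negPf qk]; rewrite /z mxE qj qk mulr1.
  rewrite -/s [A i k * b + s]addrC /a [A i j * _]mulrC divfK // addNr mul0r => /esym/eqP.
  apply/negP/prodf_neq0 => q _; rewrite mxE.
  case: ifP => _; first by rewrite mulf_neq0 ?oppr_eq0 ?invr_eq0.
  by case: ifP => _ //; exact: oner_neq0.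
apply/rowP => q; rewrite {1}LA !mxE (bigD1 j) //= big1 ?addr0 // => k kj.
by rewrite Aik ?mul0r.
Qed.

(** Finitely many integer points decide the equality of two such products, so finitely many tables
    of values leave only finitely many products. *)
Lemma eq_prod_linear_forms_grid (F : numFieldType) (n : nat) (L1 L2 : 'M[F]_n) :
  (forall x : {ffun 'I_n -> 'I_n.+1},
     \prod_i (L1 *m \col_j (x j)%:R) i 0 = \prod_i (L2 *m \col_j (x j)%:R) i 0) ->
  forall y : 'cV[F]_n, \prod_i (L1 *m y) i 0 = \prod_i (L2 *m y) i 0.
Proof.
move=> eqL.
(* Free the coordinates one at a time: in each of them both sides are
   polynomials of degree at most [n]. *)
suff H k : (k <= n)%N -> forall y : 'cV[F]_n,
    (forall j : 'I_n, (k <= j)%N -> exists a : 'I_n.+1, y j 0 = a%:R) ->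
    \prod_i (L1 *m y) i 0 = \prod_i (L2 *m y) i 0.
  by move=> y; apply: (H n) => // j; rewrite leqNgt ltn_ord.
elim: k => [_ y yg|k IHk kn y yg].
  have [x yx] : exists x : {ffun 'I_n -> 'I_n.+1}, y = \col_j (x j)%:R.
    have [x Hx] := choice (fun j => yg j (leq0n _)).
    by exists (finfun x); apply/colP => j; rewrite mxE ffunE.
  by rewrite yx.
pose j0 := Ordinal kn.
pose yt t : 'cV[F]_n := y + (t - y j0 0) *: delta_mx j0 0.

pose Pol (L : 'M[F]_n) : {poly F} :=
  \prod_i (((L *m y) i 0 - y j0 0 * L i j0)%:P + (L i j0) *: 'X).
have PolE L t : (Pol L).[t] = \prod_i (L *m yt t) i 0.
  rewrite horner_prod; apply: eq_bigr => i _.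
  rewrite !hornerE mulmxDr -scalemxAr -colE !mxE; ring.
have sPol L : (size (Pol L) <= n.+1)%N.
  apply: leq_trans (size_prod_leq _ _) _.
  rewrite leq_subLR addnS ltnS.
  apply: leq_trans (_ : (\sum_(i < n) 2 <= _)%N); last first.
    by rewrite sum_nat_const cardE size_enum_ord muln2 -addnn.
  apply: leq_sum => i _.
  apply: leq_trans (size_polyD _ _) _; rewrite geq_max.
  rewrite (leq_trans (size_polyC_leq1 _)) //=.
  by rewrite (leq_trans (size_scale_leq _ _)) ?size_polyX.
have yE : y = yt (y j0 0) by rewrite /yt subrr scale0r addr0.
rewrite yE -!PolE; congr (_.[_]); apply/eqP; rewrite -subr_eq0; apply/eqP.
apply: (@roots_geq_poly_eq0 _ _ [seq a%:R | a <- iota 0 n.+1]).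
- apply/allP => t /mapP[a]; rewrite mem_iota /= add0n => an ->.
  rewrite /root hornerD hornerN !PolE subr_eq0; apply/eqP.
  apply: IHk => [|j]; first exact: ltnW.
  rewrite leq_eqVlt => /orP[/eqP kj|kj]; last first.
    have [b yb] := yg j kj; exists b; rewrite !mxE -yb.
    have /negPf-> : j != j0 by apply/eqP => jj; move: kj; rewrite jj ltnn.
    by rewrite /= mulr0 addr0.
  have jj : j = j0 by apply: val_inj.
  rewrite jj.  by exists (Ordinal an); rewrite !mxE !eqxx mulr1 addrC subrK.
- rewrite map_inj_uniq ?iota_uniq // => a b /eqP; rewrite eqr_nat; exact/eqP.
- rewrite size_map size_iota; apply: leq_trans (size_polyD _ _) _.
  by rewrite geq_max size_polyN !sPol.
Qed.

(** The Smith normal form of a single column is supported on its top entry. Its left factor may have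
    determinant -1; [E] corrects this by a sign on the last coordinate, which differs from the first
    one in dimension at least 2. *)
Lemma int_col_SL_orbit (n : nat) (w : 'cV[int]_n.+2) :
  exists (g : 'M[int]_n.+2) (d : int),
    \det g = 1 /\ w = g *m (d *: delta_mx 0 0).
Proof.
have [g ug [r ur [s _ ->]]] := int_Smith_normal_form w.
pose a := r 0 0.
have [e e1 De] : exists2 e : int, e * e = 1 & \det g = e.
  have : \det g \is a GRing.unit by rewrite -unitmxE.
  by rewrite qualifE /= => /orP[]/eqP ->; [exists 1|exists (-1)].
pose E : 'M[int]_n.+2 := \matrix_(i, j) if i == j then if i == ord_max then e else 1 else 0.
have dE : E = diag_mx (\row_i if i == ord_max then e else 1).
  by apply/matrixP => i j; rewrite !mxE; case: eqVneq => [->|] //=; rewrite ?mulr1n ?mulr0n.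
exists (g *m E), (s`_0 * a); split.
  rewrite det_mulmx De dE det_diag (bigD1 ord_max) //= mxE eqxx big1 ?mulr1 //.
  by move=> i /negPf; rewrite mxE => ->.
rewrite -2!mulmxA; congr (g *m _). rewrite -scalemxAr; apply/colP => i.
rewrite !mxE big_ord1 !mxE /= (bigD1 0) //= big1 => [|j j0]; last first.
  by rewrite !mxE (negPf j0) mulr0.
rewrite !mxE eqxx /= mulr1 addr0.
case: (eqVneq i 0) => [->|i0] /=; first by rewrite mulr1n mulr1.
have -> : (i == 0 :> nat) = false by apply: negPf i0.
by rewrite mulr0n mul0r mulr0.
Qed.

(** * Rational matrices with an anisotropic eigenbasis *)

Lemma mulmx_horner_eigen (F : comNzRingType) (n : nat) (G : 'M[F]_n.+1)
    (v : 'rV[F]_n.+1) (a : F) (q : {poly F}) :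
  v *m G = a *: v -> v *m horner_mx G q = q.[a] *: v.
Proof.
move=> vG; elim/poly_ind: q => [|q c IHq].
  by rewrite rmorph0 mulmx0 horner0 scale0r.
rewrite rmorphD rmorphM /= horner_mx_X horner_mx_C mulmxDr mulmxA IHq.
by rewrite -scalemxAl vG mul_mx_scalar !hornerE scalerA -scalerDl.
Qed.

(** The middle clause is what the absence of rational zeros of [f] says about its factors. *)
Definition anisotropic_eigenbasis (C : numClosedFieldType) (n : nat)
    (G : 'M[rat]_n.+1) (L : 'M[C]_n.+1) (lam : 'I_n.+1 -> C) : Prop :=
  [/\ L \in unitmx,
      forall w : 'cV[rat]_n.+1, w != 0 -> forall i, (L *m map_mx ratr w) i 0 != 0 &
      forall i, row i L *m map_mx ratr G = lam i *: row i L].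

Lemma eigenbasis_horner (C : numClosedFieldType) (n : nat)
    (G : 'M[rat]_n.+1) (L : 'M[C]_n.+1) (lam : 'I_n.+1 -> C) (q : {poly rat}) i :
  anisotropic_eigenbasis G L lam ->
  row i L *m map_mx ratr (horner_mx G q) = (map_poly ratr q).[lam i] *: row i L.
Proof.
by move=> [_ _ eigL]; rewrite map_horner_mx; apply: mulmx_horner_eigen.
Qed.

(* [q(G)] kills a rational vector, on which no form [row i L] vanishes. *)
Lemma eigenbasis_conjugate (C : numClosedFieldType) (n : nat)
    (G : 'M[rat]_n.+1) (L : 'M[C]_n.+1) (lam : 'I_n.+1 -> C) (q : {poly rat}) i j :
  anisotropic_eigenbasis G L lam ->
  root (map_poly ratr q) (lam j) -> root (map_poly ratr q) (lam i).
Proof.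
move=> eigL /rootP qj; have [uL nzL _] := eigL.
have : horner_mx G q \notin unitmx.
  apply/negP; rewrite -(map_unitmx (ratr : {rmorphism rat -> C})) => uq.
  have := eigenbasis_horner q j eigL; rewrite qj scale0r => /(canRL (mulmxK uq)).
  rewrite mul0mx => rowL0.
  have : row j (L *m invmx L) = 0 by rewrite row_mul rowL0 mul0mx.
  rewrite mulmxV // => /rowP/(_ j); rewrite !mxE eqxx => /eqP.
  by rewrite oner_eq0.
rewrite -unitmx_tr unitmxE unitfE negbK => /det0P[u u0 uq].
have w0 : u^T != 0 by rewrite -(inj_eq (@trmx_inj _ _ _)) trmxK trmx0.
have qw : horner_mx G q *m u^T = 0.
  by apply: trmx_inj; rewrite trmx_mul trmxK uq trmx0.
have := congr1 (fun A => A *m map_mx ratr u^T) (eigenbasis_horner q i eigL).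
rewrite -mulmxA -map_mxM qw map_mx0 mulmx0 -scalemxAl -row_mul.
have rE (A : 'cV[C]_n.+1) : row i A 0 0 = A i 0 by rewrite mxE.
move=> /rowP/(_ 0); rewrite [RHS]mxE rE mxE => /esym/eqP.
by rewrite mulf_eq0 (negPf (nzL _ w0 i)) orbF rootE.
Qed.

Lemma eigenbasis_char_poly (C : numClosedFieldType) (n : nat)
    (G : 'M[rat]_n.+1) (L : 'M[C]_n.+1) (lam : 'I_n.+1 -> C) :
  anisotropic_eigenbasis G L lam ->
  map_poly ratr (char_poly G) = \prod_i ('X - (lam i)%:P).
Proof.
move=> [uL _ eigL]; pose D := diag_mx (\row_i lam i).
have LD : L *m map_mx ratr G = D *m L.
  apply/row_matrixP => i; rewrite row_mul eigL.
  by rewrite row_mul row_diag_mx -scalemxAl -rowE mxE.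
pose LP := map_mx polyC L.
have conj : LP *m char_poly_mx (map_mx ratr G) = char_poly_mx D *m LP.
  by rewrite mulmxBr mulmxBl -!map_mxM LD scalar_mxC.
have dLP : \det LP != 0 by rewrite det_map_mx polyC_eq0 -unitfE -unitmxE.
have : char_poly (map_mx ratr G) = char_poly D.
  by apply: (mulfI dLP); rewrite /char_poly -det_mulmx conj det_mulmx mulrC.
rewrite map_char_poly => ->; rewrite char_poly_trig.
  by apply: eq_bigr => i _; rewrite !mxE eqxx.
by apply/is_trig_mxP => i j ij; rewrite mxE -val_eqE /= ltn_eqF.
Qed.

(** The derivative of [char_poly G] is a rational polynomial, so if it vanished at some [lam i] it
    would vanish at the simple root [lam i0]. *)
Lemma eigenbasis_simple_root (C : numClosedFieldType) (n : nat)
    (G : 'M[rat]_n.+1) (L : 'M[C]_n.+1) (lam : 'I_n.+1 -> C) i0 :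
  anisotropic_eigenbasis G L lam -> (forall j, j != i0 -> lam j != lam i0) ->
  forall i, ~~ root (map_poly ratr (char_poly G)^`()) (lam i).
Proof.
move=> eigL simp i; apply/negP => /(eigenbasis_conjugate i0 eigL).
rewrite -deriv_map (eigenbasis_char_poly eigL) (bigD1 i0) //=.
rewrite derivM derivXsubC mul1r /root !hornerE subrr mul0r addr0 horner_prod.
apply/negP/prodf_neq0 => j ji0.
by rewrite !hornerE subr_eq0 eq_sym simp.
Qed.

Lemma eigenbasis_inj (C : numClosedFieldType) (n : nat)
    (G : 'M[rat]_n.+1) (L : 'M[C]_n.+1) (lam : 'I_n.+1 -> C) i0 :
  anisotropic_eigenbasis G L lam -> (forall j, j != i0 -> lam j != lam i0) ->
  injective lam.
Proof.
move=> eigL simp i j lij; apply/eqP; apply: contraT => ij.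
have := eigenbasis_simple_root eigL simp i.
rewrite -deriv_map (eigenbasis_char_poly eigL) (bigD1 i) //= (bigD1 j) 1?eq_sym //=.
by rewrite lij /root !derivM !derivXsubC !hornerE subrr ?mul0r ?addr0 ?eqxx.
Qed.

(** A nonconstant factor vanishes at some [lam j], hence at [lam i0]; two nonconstant factors would
    make [lam i0] a multiple root. *)
Lemma eigenbasis_irreducible (C : numClosedFieldType) (n : nat)
    (G : 'M[rat]_n.+1) (L : 'M[C]_n.+1) (lam : 'I_n.+1 -> C) i0 :
  anisotropic_eigenbasis G L lam -> (forall j, j != i0 -> lam j != lam i0) ->
  irreducible_poly (char_poly G).
Proof.
move=> eigL simp; have p0 : char_poly G != 0 by rewrite monic_neq0 ?char_poly_monic.
have all_roots q : q %| char_poly G -> size q != 1%N -> root (map_poly ratr q) (lam i0).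
  move=> qp q1; have : size (map_poly (ratr : rat -> C) q) != 1%N by rewrite size_map_poly.
  case/closed_rootP => x qx.
  have : root (map_poly ratr (char_poly G)) x.
    by move: qx; rewrite -!dvdp_XsubCl => /dvdp_trans; apply; rewrite dvdp_map.
  rewrite (eigenbasis_char_poly eigL) -(big_map lam predT (fun x => 'X - x%:P)).
  rewrite root_prod_XsubC => /mapP[j _ xj].
  by apply: (@eigenbasis_conjugate _ _ _ _ _ _ _ j eigL); rewrite -xj.
split=> [|q q1 qp]; first by rewrite size_char_poly.
case/dvdpP: (qp) => r Dp.
have [/eqP/size_poly1P[c c0 rc]|r1] := eqVneq (size r) 1%N.
  by rewrite Dp rc mul_polyC eqp_sym eqp_scale.
have rp : r %| char_poly G by rewrite Dp dvdp_mulr.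
have /negP[] := eigenbasis_simple_root eigL simp i0.
rewrite Dp derivM rmorphD !rmorphM /= rootE !hornerE.
by rewrite (rootP (all_roots q qp q1)) (rootP (all_roots r rp r1)) mulr0 mul0r addr0.
Qed.

(** Every element of [K] is a polynomial in [z]. Evaluating a chosen representative at [x] does not
    depend on the choice: by irreducibility [p] divides every polynomial vanishing at [z]. *)
Lemma simple_ext_embedding (K : fieldExtType rat) (C : numClosedFieldType)
    (p : {poly rat}) (z : K) (x : C) :
  irreducible_poly p -> root (map_poly (in_alg K) p) z -> <<1; z>>%VS = fullv ->
  root (map_poly ratr p) x ->
  exists theta : {rmorphism K -> C},
    forall q, theta (map_poly (in_alg K) q).[z] = (map_poly ratr q).[x].
Proof.
move=> irp pz Kz px.
have gen y : exists q, y = (map_poly (in_alg K) q).[z].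
  by apply/Fadjoin1_polyP; rewrite Kz memvf.
have [rep repE] := choice gen.
pose theta y := (map_poly (ratr : rat -> C) (rep y)).[x].
have thetaE q : theta (map_poly (in_alg K) q).[z] = (map_poly ratr q).[x].
  set y := _.[z]; apply/eqP; rewrite -subr_eq0 -hornerN -hornerD -rmorphB /=.
  have : p %| rep y - q.
    rewrite -[_ %| _]negbK -irreducible_poly_coprime // -(coprimep_map (in_alg K)).
    apply/negP => /coprimep_root/(_ pz)/negP[].
    by rewrite rmorphB hornerD hornerN -repE subrr.
  rewrite -(dvdp_map (ratr : {rmorphism rat -> C})); move: px.
  by rewrite -dvdp_XsubCl => /dvdp_trans/[apply]; rewrite dvdp_XsubCl rootE.
have addT : zmod_morphism theta.
  move=> a b; have [q aq] := gen a; have [r br] := gen b.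
  by rewrite aq br -hornerN -hornerD -rmorphB !thetaE rmorphB !hornerE.
have mulT : monoid_morphism theta.
  split.
    by rewrite -(hornerC 1 z) -[1%:P](rmorph1 (map_poly (in_alg K))) thetaE rmorph1 hornerC.
  move=> a b; have [q aq] := gen a; have [r br] := gen b.
  by rewrite aq br -hornerM -rmorphM !thetaE rmorphM !hornerE.
pose tA := GRing.isZmodMorphism.Build K C theta addT.
pose tM := GRing.isMonoidMorphism.Build K C theta mulT.
pose th : {rmorphism K -> C} := HB.pack theta tA tM.
by exists th.
Qed.

(** * Construction of the norm form *)

Lemma meval_linear_form (n : nat) (F : comNzRingType) (l : 'rV[F]_n) (y : 'cV[F]_n) :
  (linear_form l).@[fun j => y j 0] = (l *m y) 0 0.
Proof.
rewrite /linear_form raddf_sum /= mxE; apply: eq_bigr => j _.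
by rewrite mevalZ mevalXU.
Qed.

Lemma linear_formZ (n : nat) (F : nzRingType) (a : F) (l : 'rV[F]_n) :
  linear_form (a *: l) = a *: linear_form l.
Proof.
rewrite /linear_form scaler_sumr; apply: eq_bigr => j _.
by rewrite mxE scalerA.
Qed.

Lemma meval_complex_mpoly (R : realType) (n : nat) (f : {mpoly R[n]})
    (y : 'cV[R]_n) :
  (complex_mpoly f).@[fun j => (map_mx (real_complex R) y) j 0] =
  real_complex R f.@[fun j => y j 0].
Proof.
rewrite /complex_mpoly (map_mpolyE _ (leqnn _)) [in RHS](mpolywE (leqnn (msize f))).
rewrite [LHS]raddf_sum (raddf_sum (meval (fun j => y j 0))) [RHS]raddf_sum /=.
apply: eq_bigr => m _.
rewrite !mevalZ !mevalX rmorphM rmorph_prod; congr (_ * _).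
by apply: eq_bigr => j _; rewrite mxE rmorphXn.
Qed.

Lemma meval_prod_linear_form (n : nat) (F : comNzRingType) (L : 'M[F]_n) (y : 'cV[F]_n) :
  (\prod_(i < n) linear_form (row i L)).@[fun j => y j 0] =
  \prod_(i < n) (L *m y) i 0.
Proof.
rewrite rmorph_prod; apply: eq_bigr => i _.
by rewrite /= meval_linear_form -row_mul mxE.
Qed.

Lemma meval_factors_as (R : realType) (n : nat) (f : {mpoly R[n]})
    (L : 'M[R[i]]_n) (y : 'cV[R]_n) :
  factors_as f L -> real_complex R f.@[fun j => y j 0] =
  \prod_(i < n) (L *m map_mx (real_complex R) y) i 0.
Proof.
by move=> [_ fL]; rewrite -meval_complex_mpoly fL meval_prod_linear_form.
Qed.

Lemma mx_act1 (n : nat) (F : comUnitRingType) (p : {mpoly F[n]}) :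
  mx_act 1%:M p = p.
Proof.
rewrite /mx_act -[RHS]comp_mpoly_id; congr (_ \mPo _).
apply: eq_from_tnth => i; rewrite !tnth_mktuple invmx1 /linear_form.
rewrite (bigD1 i) //= big1 => [|j ji]; last by rewrite !mxE eq_sym (negPf ji) scale0r.
by rewrite !mxE eqxx scale1r addr0.
Qed.

Lemma morph_rat_alg (K : fieldExtType rat) (C : numFieldType)
    (phi : {rmorphism K -> C}) (a : rat) : phi a%:A = ratr a.
Proof. exact: (fmorph_eq_rat (phi \o in_alg K)). Qed.

Lemma morph_rat_horner (K : fieldExtType rat) (C : numFieldType)
    (phi : {rmorphism K -> C}) (q : {poly rat}) (z : K) :
  phi (map_poly (in_alg K) q).[z] = (map_poly ratr q).[phi z].
Proof.
rewrite -horner_map /= -map_poly_comp; congr (_.[_]).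
by apply: eq_map_poly => a; rewrite /= morph_rat_alg.
Qed.

(** [K] is generated by a root [z] of [char_poly G], and [theta i] sends [z] to [lam i]. Matching
    [q(z)] with [q(G) v0] identifies [K] with the rational vectors; the [i]-th form becomes [l i]
    times [theta i], and [alpha] corresponds to the standard basis. *)
Lemma norm_form_of_eigenbasis (R : realType) (n : nat) (f : {mpoly R[n.+1]})
    (L : 'M[R[i]]_n.+1) (G : 'M[rat]_n.+1) (lam : 'I_n.+1 -> R[i]) i0 :
  factors_as f L -> anisotropic_eigenbasis G L lam ->
  (forall j, j != i0 -> lam j != lam i0) -> norm_form f.
Proof.
move=> fL eigL simp; have [_ nzL _] := eigL.
have lam_inj := eigenbasis_inj eigL simp.
have irp := eigenbasis_irreducible eigL simp.
have [K dimK [z pz Kz]] := irredp_FAdjoin irp.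
rewrite size_char_poly /= in dimK.
have root_lam x : root (map_poly ratr (char_poly G)) x -> exists i, x = lam i.
  rewrite (eigenbasis_char_poly eigL) -(big_map lam predT (fun x => 'X - x%:P)).
  by rewrite root_prod_XsubC => /mapP[i _ ->]; exists i.
have plam i : root (map_poly ratr (char_poly G)) (lam i).
  rewrite (eigenbasis_char_poly eigL) -(big_map lam predT (fun x => 'X - x%:P)).
  by rewrite root_prod_XsubC map_f ?mem_index_enum.
have [theta thetaE] := choice (fun i => simple_ext_embedding irp pz Kz (plam i)).
pose v0 : 'cV[rat]_n.+1 := delta_mx 0 0.
have v00 : v0 != 0.
  by apply/eqP => /colP/(_ 0); rewrite !mxE eqxx => /eqP; rewrite oner_eq0.
pose l i := (L *m map_mx ratr v0) i 0.
have l0 i : l i != 0 by apply: nzL.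
have lE q i : (L *m map_mx ratr (horner_mx G q *m v0)) i 0 =
              (map_poly ratr q).[lam i] * l i.
  have rE (A : 'cV[R[i]]_n.+1) : A i 0 = row i A 0 0 by rewrite mxE.
  rewrite rE row_mul map_mxM mulmxA (eigenbasis_horner q i eigL).
  by rewrite -scalemxAl mxE -row_mul -rE.
pose V : 'M[rat]_n.+1 := \matrix_(i, k) (G ^+ k *m v0) i 0.
have VE u : horner_mx G (rVpoly u) *m v0 = V *m u^T.
  rewrite horner_rVpoly mulmx_sum_row linear_sum /= mulmx_suml.
  apply/colP => i; rewrite summxE mxE; apply: eq_bigr => k _.
  by rewrite linearZ /= rowK mxvecK -scalemxAl [LHS]mxE mulrC [V i k]mxE [u^T k 0]mxE.
(* The vector [v0] is cyclic: a polynomial of degree at most [n] killing it has the [n.+1] distinct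
   [lam i] as roots. *)
have uV : V \in unitmx.
  rewrite -unitmx_tr unitmxE unitfE; apply/negP => /det0P[u u0 uV0].
  have qv : horner_mx G (rVpoly u) *m v0 = 0.
    by rewrite VE; apply: trmx_inj; rewrite trmx_mul trmxK uV0 trmx0.
  have q0 : map_poly (ratr : {rmorphism rat -> R[i]}) (rVpoly u) = 0.
    apply: (@roots_geq_poly_eq0 _ _ (codom lam)).
    - apply/allP => x /codomP[i ->]; have := lE (rVpoly u) i.
      rewrite qv map_mx0 mulmx0 mxE => /esym/eqP.
      by rewrite mulf_eq0 (negPf (l0 i)) orbF.
    - by rewrite map_inj_uniq ?enum_uniq.
    - by rewrite size_map_poly size_codom card_ord size_poly.
  move/eqP: q0; rewrite map_poly_eq0 => /eqP q0.
  by move: u0; rewrite -[u]rVpolyK q0 linear0 eqxx.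
(* Evaluated at [G], [q j] sends [v0] to the [j]-th standard basis vector. *)
pose q j := rVpoly (row j (invmx V)^T).
pose alpha := [tuple (map_poly (in_alg K) (q j)).[z] | j < n.+1].
have thetaA i j : L i j = l i * theta i (tnth alpha j).
  rewrite tnth_mktuple thetaE mulrC -lE /q VE -tr_col trmxK colE mulmxA.
  by rewrite mulmxV // mul1mx map_delta_mx -colE mxE.
(* The coefficients of a relation among the [alpha] form a rational vector killed by the form of
   index 0. *)
have freeA : free alpha.
  apply/freeP => k ka.
  suff w0 : \col_j k j = 0 by move=> j; move/colP: w0 => /(_ j); rewrite !mxE.
  apply/eqP; apply: contraT => /nzL/(_ 0)/negP[]; rewrite mxE.
  rewrite (eq_bigr (fun j => l 0 * theta 0 (k j *: alpha`_j))).
    by rewrite -mulr_sumr -rmorph_sum ka rmorph0 mulr0.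
  move=> j _; rewrite thetaA !mxE -mulr_algl rmorphM morph_rat_alg.
  by rewrite -tnth_nth -mulrA [_ * ratr _]mulrC.
(* With [c] the value of [f] at [v0], [f] is itself [c] times the norm form, and the equivalence is
   by the identity matrix. *)
pose c : R := f.@[fun j => (map_mx ratr v0 : 'cV[R]_n.+1) j 0].
have cE : real_complex R c = \prod_i l i.
  rewrite (meval_factors_as _ fL) -map_mx_comp; apply: eq_bigr => i _.
  rewrite (_ : map_mx _ v0 = map_mx ratr v0) //.
  by apply/matrixP => ? ?; rewrite !mxE /= fmorph_rat.
exists K, alpha, theta, c, f; split => //.
- by rewrite basisEfree freeA subvf size_tuple dimK leqnn.
- split=> [i j tij|phi].
    apply: lam_inj; have := tij z; have zE : z = (map_poly (in_alg K) 'X).[z].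
      by rewrite map_polyX hornerX.
    by rewrite zE !thetaE !map_polyX !hornerX.
  have [|i phiz] := root_lam (phi z).
    by rewrite rootE -morph_rat_horner (rootP pz) rmorph0.
  exists i => y; have /Fadjoin1_polyP[r ->] : y \in <<1; z>>%VS by rewrite Kz memvf.
  by rewrite thetaE morph_rat_horner phiz.
- have : real_complex R c != 0 by rewrite cE; apply/prodf_neq0.
  by apply: contraNneq => ->.
- split; last by exists 1%:M; rewrite ?det1 ?map_mx1 ?mx_act1.
  rewrite cE fL.2.
  rewrite /field_norm_form -scaler_prod; apply: eq_bigr => i _.
  rewrite -linear_formZ; congr linear_form.
  by apply/rowP => j; rewrite !mxE thetaA.
Qed.

(** * Values on the integer lattice *)

Lemma int_value_factors (R : realType) (n : nat) (f : {mpoly R[n]})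
    (L : 'M[R[i]]_n) (w : 'cV[int]_n) :
  factors_as f L -> real_complex R f.@[fun j => (w j 0)%:~R] =
  \prod_(i < n) (L *m map_mx intr w) i 0.
Proof.
move=> fL; rewrite (_ : f.@[_] = f.@[fun j => (map_mx intr w : 'cV[R]_n) j 0]).
  rewrite (meval_factors_as _ fL); apply: eq_bigr => i _; congr ((L *m _) i 0).
  by apply/matrixP => j k; rewrite !mxE rmorph_int.
by apply: meval_eq => j; rewrite mxE.
Qed.

Lemma int_value_scale (R : realType) (n : nat) (f : {mpoly R[n]})
    (L : 'M[R[i]]_n) (a : int) (w : 'cV[int]_n) :
  factors_as f L ->
  f.@[fun j => ((a *: w) j 0)%:~R] = a%:~R ^+ n * f.@[fun j => (w j 0)%:~R].
Proof.
move=> fL; apply: (@complexI R).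
rewrite rmorphM rmorphXn rmorph_int /= !(int_value_factors _ fL).
rewrite (_ : a%:~R ^+ n = \prod_(i < n) a%:~R); last by rewrite prodr_const card_ord.
rewrite -big_split /=; apply: eq_bigr => i _.
by rewrite map_mxZ -scalemxAr mxE.
Qed.

Lemma nonzero_int_value (R : realType) (n : nat) (f : {mpoly R[n]}) (w : 'cV[int]_n) :
  ~ represents_zero_over_Q f -> w != 0 -> f.@[fun j => (w j 0)%:~R] != 0.
Proof.
move=> nz w0; apply/eqP => fw; case: nz; exists (map_mx intr w).
  apply: contraNneq w0 => /matrixP w0; apply/eqP/matrixP => j k.
  by have /eqP := w0 j k; rewrite !mxE intr_eq0 => /eqP.
by rewrite -fw; apply: meval_eq => j; rewrite mxE ratr_int.
Qed.

(** Some vector of [Z] is [d] times a primitive one, so [Z] contains [d] times every primitive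
    vector. As [w] is [m] times a primitive vector, homogeneity relates its value to one on [Z]. *)
Lemma invariant_set_values (R : realType) (n : nat) (f : {mpoly R[n.+2]})
    (L : 'M[R[i]]_n.+2) (Z : set 'cV[int]_n.+2) :
  factors_as f L -> (Z !=set0)%classic -> ~ Z 0 -> SLZ_invariant Z ->
  exists2 d : int, d != 0 & forall w : 'cV[int]_n.+2, w != 0 -> exists2 m : int, m != 0 &
    exists2 y, int_values f Z y &
      d%:~R ^+ n.+2 * f.@[fun j => (w j 0)%:~R] = m%:~R ^+ n.+2 * y.
Proof.
move=> fL [z Zz] Z0 invZ.
have [g [d [dg zE]]] := int_col_SL_orbit z.
have d0 : d != 0.
  by apply/eqP => d0; apply: Z0; rewrite -[0](_ : z = _) // zE d0 scale0r mulmx0.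
have Zd : Z (d *: delta_mx 0 0).
  have ug : g \in unitmx by rewrite unitmxE dg unitr1.
  rewrite -[_ *: _](mulKmx ug) -zE; apply: invZ => //.
  by rewrite det_inv dg invr1.
exists d => // w w0; have [h [m [dh wE]]] := int_col_SL_orbit w.
exists m; first by apply: contraNneq w0 => m0; rewrite wE m0 scale0r mulmx0.
pose w' : 'cV[int]_n.+2 := h *m (d *: delta_mx 0 0).
exists f.@[fun j => (w' j 0)%:~R]; first by exists w' => //; apply: invZ.
rewrite wE /w' -!scalemxAr !(int_value_scale _ _ fL); ring.
Qed.

Lemma finite_bounded_discrete (R : realType) (A : set R) (M : R) :
  discrete_in_R A -> finite_set [set y | A y /\ `|y| <= M]%classic.
Proof.
move=> dA; apply: contrapT => infA.
have bnd : bounded_set [set y | A y /\ `|y| <= M]%classic.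
  exists M; split; first exact: num_real.
  by move=> N MN y [_ yM]; apply: le_trans yM (ltW MN).
have [x xA] := infinite_bounded_limit_point_nonempty infA bnd.
suff : limit_point A x by rewrite dA.
by move=> U /xA [y [yx [Ay _] Uy]]; exists y.
Qed.

Lemma discrete_away_from_0 (R : realType) (A : set R) :
  discrete_in_R A -> exists2 c : R, 0 < c & forall y, A y -> y != 0 -> c <= `|y|.
Proof.
move=> dA; have : ~ limit_point A (0 : R) by rewrite dA.
rewrite /limit_point /= => /existsNP[U /not_implyP[/nbhs_ballP[c c0 cU] noU]].
exists c => // y Ay y0; rewrite leNgt; apply/negP => yc; apply: noU.
by exists y; split => //; apply: cU; rewrite /ball /= sub0r normrN.
Qed.

Lemma finite_bounded_int (B : nat) : finite_set [set m : int | (`|m| <= B)%N]%classic.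
Proof.
apply: (@sub_finite_set _ _ ((Posz @` `I_B.+1) `|` ((fun k => - Posz k) @` `I_B.+1))%classic).
  move=> [k|k] /= kB; [left|right]; first by exists k.
  by exists k.+1.
by rewrite finite_setU; split; apply: finite_image.
Qed.

Lemma norm_intr_ge1 (R : realDomainType) (m : int) : m != 0 -> 1 <= `|m%:~R : R|.
Proof. by move=> m0; rewrite -intr_norm ler1z -gtz0_ge1 normr_gt0. Qed.

(** For nonzero [w], the value of [f] is [m ^ n.+2 * y / d ^ n.+2] with [y] a value on [Z]. The
    bound [c <= |y|] gives the lower bound on [f]; for values at most [M] it also bounds [m],
    leaving finitely many [m] and [y]. *)
Lemma values_on_lattice (R : realType) (n : nat) (f : {mpoly R[n.+2]})
    (L : 'M[R[i]]_n.+2) (Z : set 'cV[int]_n.+2) :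
  factors_as f L -> (Z !=set0)%classic -> ~ Z 0 -> SLZ_invariant Z ->
  discrete_in_R (int_values f Z) -> ~ represents_zero_over_Q f ->
  (exists2 c : R, 0 < c & forall w : 'cV[int]_n.+2, w != 0 ->
     c <= `|f.@[fun j => (w j 0)%:~R]|) /\
  (forall M : R, finite_set
     [set y | `|y| <= M /\ exists w : 'cV[int]_n.+2, y = f.@[fun j => (w j 0)%:~R]]%classic).
Proof.
move=> fL Zn Z0 invZ dZ nz.
have [d d0 dP] := invariant_set_values fL Zn Z0 invZ.
have [c c0 cP] := discrete_away_from_0 dZ.
pose dn : R := `|d%:~R ^+ n.+2|.
have dn0 : 0 < dn by rewrite normr_gt0 expf_neq0 // intr_eq0.
have key (w : 'cV[int]_n.+2) : w != 0 -> exists2 m : int, m != 0 & exists y, [/\ int_values f Z y,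
    y = d%:~R ^+ n.+2 * f.@[fun j => (w j 0)%:~R] / m%:~R ^+ n.+2,
    c <= `|y| & 1 <= `|m%:~R ^+ n.+2 : R|].
  move=> w0; have [m m0 [y Zy E]] := dP w w0; exists m => //; exists y.
  have mn0 : m%:~R ^+ n.+2 != 0 :> R by rewrite expf_neq0 // intr_eq0.
  split=> //; first by rewrite E mulrAC divff ?mul1r.
    apply: cP => //; apply: contraTneq (nonzero_int_value nz w0) => y0.
    have /eqP := E; rewrite y0 mulr0 mulf_eq0 expf_eq0 /= intr_eq0 (negPf d0) /=.
    by move=> ->.
  by rewrite normrX exprn_ege1 // norm_intr_ge1.
split.
  exists (c / dn) => [|w w0]; first by rewrite divr_gt0.
  have [m m0 [y [_ yE cy m1]]] := key w w0; rewrite ler_pdivrMr // mulrC -normrM.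
  apply: le_trans cy _; rewrite yE [leLHS]normrM normfV ler_pdivrMr; last first.
    exact: lt_le_trans m1.
  by rewrite ler_peMr.
(* For a value [x], [|m| * c <= |m ^ n.+2 * y| = |d ^ n.+2 * x|]; [|M|] keeps the bound nonnegative
   for every [M]. *)
move=> M; pose B := Num.bound (dn * `|M| / c).
apply: (@sub_finite_set _ _ ([set 0] `|` [set (m%:~R ^+ n.+2 * y) / d%:~R ^+ n.+2 |
    m in [set m : int | (`|m| <= B)%N] &
    y in [set y | int_values f Z y /\ `|y| <= dn * `|M|]])%classic); last first.
  rewrite finite_setU; split; first exact: finite_set1.
  by apply: finite_image2; [exact: finite_bounded_int | exact: finite_bounded_discrete].
move=> x [xM [w xE]]; have [w0|w0] := eqVneq w 0.
  left => /=; apply: (@complexI R); rewrite xE (int_value_factors _ fL) w0 map_mx0 mulmx0.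
  by rewrite big_ord_recl mxE mul0r rmorph0.
right; have [m m0 [y [Zy yE cy m1]]] := key w w0.
have mp : 0 < `|m%:~R ^+ n.+2 : R| by apply: lt_le_trans m1.
have xM' : `|d%:~R ^+ n.+2 * x| <= dn * `|M|.
  by rewrite normrM ler_wpM2l // (le_trans xM) // ler_norm.
exists m; last first.
  exists y; last first.
    rewrite yE -xE; field.
    by rewrite -!normr_gt0 dn0 mp.
  split => //; rewrite yE normrM normfV -xE ler_pdivrMr //.
  by apply: le_trans xM' _; rewrite ler_peMr // mulr_ge0 // ltW.
rewrite /= -(ler_nat R); apply: le_trans (ltW (archi_boundP _)); last first.
  by rewrite divr_ge0 ?mulr_ge0 // ltW.
rewrite ler_pdivlMr // natr_absz.
apply: (@le_trans _ _ (`|m%:~R ^+ n.+2| * `|y|)).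
  have mle : `|m|%:~R <= `|m%:~R ^+ n.+2| :> R.
    by rewrite intr_norm normrX exprS ler_peMr // exprn_ege1 // norm_intr_ge1.
  by rewrite ler_pM ?(ltW c0) // ler0z.
rewrite -normrM yE mulrC divfK -?xE // -normr_gt0 //.
Qed.

(** * Simultaneously small integer vectors *)

(** The relation is solved for the coordinate with the largest coefficient, so the quotients
    [h q / h q0] have modulus at most 1. *)
Lemma dominated_coordinate (R : realFieldType) (n : nat) (h u : 'I_n.+1 -> R)
    (q0 : 'I_n.+1) (e : R) :
  0 <= e -> h q0 != 0 -> (forall q, `|h q| <= `|h q0|) -> \sum_q h q * u q = 0 ->
  (forall q, q != q0 -> `|u q| <= e) -> forall q, `|u q| <= n.+1%:R * e.
Proof.
move=> e0 h0 hmax hu ue q.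
have [->|/ue ueq] := eqVneq q q0; last first.
  by apply: le_trans ueq _; rewrite ler_peMl // ler1n.
have hq0 : 0 < `|h q0| by rewrite normr_gt0.
rewrite -(ler_pM2l hq0) -normrM; move: hu; rewrite (bigD1 q0) //=.
move/eqP; rewrite addr_eq0 => /eqP ->; rewrite normrN.
apply: le_trans (ler_norm_sum _ _ _) _.
apply: (@le_trans _ _ (\sum_(q < n.+1) `|h q0| * e)); last first.
  by rewrite sumr_const card_ord mulr_natl -mulrnAr.
rewrite [leRHS](bigD1 q0) //= ler_wpDl ?mulr_ge0 //.
by apply: ler_sum => j jq0; rewrite normrM ler_pM ?ue.
Qed.

(* Coordinates rescaled so that [|m x| <= e / Q^n] and [|x_q| <= e * Q]
   become [|u_q| <= e]. *)
Definition scaled_coord (R : fieldType) (n : nat) (m : 'rV[R]_n.+1) (p : 'I_n.+1)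
    (Q : nat) (x : 'cV[R]_n.+1) (q : 'I_n.+1) : R :=
  if q == p then Q%:R ^+ n * (m *m x) 0 0 else x q 0 / Q%:R.

(** In scaled coordinates the hyperplane is again given by a linear relation; [q0] is the place of
    its largest coefficient, the same for all [x]. *)
Lemma scaled_coord_hyperplane (R : realFieldType) (n : nat) (m : 'rV[R]_n.+1)
    (p : 'I_n.+1) (Q : nat) (h : 'cV[R]_n.+1) :
  (0 < Q)%N -> m 0 p != 0 -> h != 0 ->
  exists q0, forall (x : 'cV[R]_n.+1) (e : R), 0 <= e -> x^T *m h = 0 ->
    (forall q, q != q0 -> `|scaled_coord m p Q x q| <= e) ->
    forall q, `|scaled_coord m p Q x q| <= n.+1%:R * e.
Proof.
move=> Q0 mp h0.
have Q1 : (Q%:R : R) != 0 by rewrite pnatr_eq0 -lt0n.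
have Qn : (Q%:R : R) ^+ n != 0 by rewrite expf_neq0.
(* Coefficients of that relation, after eliminating [x p 0] in favour of [m *m x]. *)
pose c q := if q == p then h p 0 / (m 0 p * Q%:R ^+ n)
            else Q%:R * (h q 0 - h p 0 * m 0 q / m 0 p).
have [q0 cmax] : exists q0, forall q, `|c q| <= `|c q0|.
  case: (@arg_maxP _ _ _ ord0 xpredT (fun q => `|c q|) isT) => q0 _ cmax.
  by exists q0 => q; apply: cmax.
have c0 : c q0 != 0.
  apply: contraNneq h0 => cq0.
  have cz q : c q = 0 by apply/eqP; rewrite -normr_le0 -(normr0 R) -cq0 cmax.
  have hp : h p 0 = 0.
    have := cz p; rewrite /c eqxx => /eqP; rewrite mulf_eq0 invr_eq0 mulf_eq0.
    by rewrite (negPf mp) (negPf Qn) !orbF => /eqP.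
  apply/eqP/colP => q; rewrite [RHS]mxE; have := cz q; rewrite /c.
  case: eqP => [->//|_] /eqP; rewrite mulf_eq0 (negPf Q1) /= hp.
  by rewrite !mul0r subr0 => /eqP.
exists q0 => x e e0 hx; apply: (dominated_coordinate e0 c0 cmax).
have : (x^T *m h) 0 0 = 0 by rewrite hx mxE.
rewrite mxE (bigD1 p) //= => hx0.
have mxp : (m *m x) 0 0 = m 0 p * x p 0 + \sum_(j | j != p) m 0 j * x j 0.
  by rewrite mxE (bigD1 p).
rewrite (bigD1 p) //=.
rewrite (eq_bigr (fun q => x^T 0 q * h q 0 - h p 0 / m 0 p * (m 0 q * x q 0))); last first.
  move=> q /negPf qp; rewrite /c /scaled_coord qp mxE; field.
  by rewrite Q1 mp.
rewrite sumrB -mulr_sumr /c /scaled_coord eqxx mxp.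
move/eqP: hx0; rewrite addrC addr_eq0 => /eqP ->.
by rewrite mxE; field; rewrite mp Qn.
Qed.

Lemma scaled_coord_bound (R : realFieldType) (n : nat) (m : 'rV[R]_n.+1)
    (p : 'I_n.+1) (Q : nat) (x : 'cV[R]_n.+1) (e : R) :
  (0 < Q)%N -> m 0 p != 0 -> 0 <= e ->
  (forall q, `|scaled_coord m p Q x q| <= e) ->
  `|(m *m x) 0 0| <= e / Q%:R ^+ n /\
  forall q, `|x q 0| <= (1 + (1 + \sum_j `|m 0 j|) / `|m 0 p|) * e * Q%:R.
Proof.
move=> Q0 mp e0 ue.
have Qp : 0 < (Q%:R : R) by rewrite ltr0n.
have mx : `|(m *m x) 0 0| <= e / Q%:R ^+ n.
  have := ue p; rewrite /scaled_coord eqxx normrM ger0_norm ?exprn_ge0 ?ler0n //.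
  by rewrite ler_pdivlMr ?exprn_gt0 // mulrC.
split=> // q; have mp0 : 0 < `|m 0 p| by rewrite normr_gt0.
have xq j : j != p -> `|x j 0| <= e * Q%:R.
  move=> /negPf jp; have := ue j; rewrite /scaled_coord jp normrM normfV.
  by rewrite (ger0_norm (ler0n _ Q)) ler_pdivrMr.
have eQ0 : 0 <= e * Q%:R by rewrite mulr_ge0 ?ler0n.
have S0 : 0 <= \sum_j `|m 0 j| by apply: sumr_ge0.
have [->|/xq qb] := eqVneq q p; last first.
  apply: le_trans qb _; rewrite -mulrA ler_peMl // lerDl divr_ge0 // ?ltW //.
  by rewrite ltr_wpDr.
apply: (@le_trans _ _ ((1 + \sum_j `|m 0 j|) / `|m 0 p| * e * Q%:R)); last first.
  by rewrite -!(mulrA _ e) ler_wpM2r // lerDr.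
rewrite -(mulrA _ e) mulrAC ler_pdivlMr // mulrC -normrM.
have -> : m 0 p * x p 0 = (m *m x) 0 0 - \sum_(j | j != p) m 0 j * x j 0.
  by rewrite mxE (bigD1 p) //= addrK.
apply: le_trans (ler_normB _ _) _; rewrite mulrDl mul1r lerD //.
  apply: le_trans mx _; rewrite ler_wpM2l //.
  apply: (@le_trans _ _ 1); last by rewrite ler1n.
  by rewrite invf_le1 ?exprn_gt0 // exprn_ege1 // ler1n.
apply: le_trans (ler_norm_sum _ _ _) _.
rewrite mulr_suml [leRHS](bigD1 p) //= ler_wpDl ?mulr_ge0 //.
by apply: ler_sum => j jp; rewrite normrM ler_wpM2l ?xq.
Qed.

Lemma truncn_eq_dist (R : archiRealDomainType) (a b : R) :
  0 <= a -> 0 <= b -> Num.truncn a = Num.truncn b -> `|a - b| <= 1.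
Proof.
move=> /truncn_itv/andP[a1 a2] /truncn_itv/andP[b1 b2] ab.
rewrite ab in a1 a2; rewrite ler_norml; move: a2 b2; rewrite -natr1 => a2 b2.
by apply/andP; split; lra.
Qed.

(* Dirichlet's pigeonhole, used twice: a cube of integer points is cut into
   slabs according to the value of [m]; were the differences within each slab
   contained in a hyperplane, the remaining [n] coordinates would, by the
   separation hypothesis, leave too little room for all points. *)
Lemma small_value_basis (R : realType) (n : nat) (m : 'rV[R]_n.+1) (delta : R) :
  m != 0 -> 0 < delta ->
  exists2 B : R, 0 < B & forall Q : nat, (0 < Q)%N ->
    (forall v : 'cV[int]_n.+1,
       `|(m *m map_mx intr v) 0 0| <= delta / Q%:R ^+ n ->
       (forall j, `|(v j 0)%:~R : R| <= delta * Q%:R) -> v = 0) ->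
    exists b : 'M[int]_n.+1,
      [/\ (map_mx intr b : 'M[R]_n.+1) \in unitmx,
          forall k, `|(m *m map_mx intr b) 0 k| <= B / Q%:R ^+ n &
          forall j k, `|(b j k)%:~R : R| <= B * Q%:R].
Proof.
move=> /rV0Pn[p mp] d0.
pose S := \sum_j `|m 0 j|; have S0 : 0 <= S by apply: sumr_ge0.
pose K := 1 + (1 + S) / `|m 0 p|.
have K0 : 0 < K by rewrite ltr_pwDl // divr_ge0 // addr_ge0.
have K1 : 1 <= K by rewrite lerDl divr_ge0 // addr_ge0.
(* [scaled_coord_hyperplane] loses a factor [n.+1] and [scaled_coord_bound] the factor [K], so
   closeness up to [e] ends at [delta]. *)
pose e := delta / (n.+1%:R * K).
have e0 : 0 < e by rewrite divr_gt0 // mulr_gt0 // ltr0n.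
have eK : K * (n.+1%:R * e) = delta.
  by rewrite /e; field; rewrite gt_eqF // nat1r pnatr_eq0.
pose D := Num.bound e^-1.
have De : e^-1 < D%:R by rewrite archi_boundP // invr_ge0 ltW.
pose A := Num.bound S; have AS : S < A%:R by rewrite archi_boundP.
(* Side of the cube in units of [Q]: independent of [Q], and one above the critical value of the
   final count. *)
pose W := (2 * A * D ^ n).+1.
have W0 : 0 < (W%:R : R) by rewrite ltr0n.
exists W%:R => // Q Q0 sep; apply: contrapT => nob.
have Qp : 0 < (Q%:R : R) by rewrite ltr0n.
have Qn : 0 < (Q%:R : R) ^+ n by rewrite exprn_gt0.
pose T := {ffun 'I_n.+1 -> 'I_(W * Q)}.
pose X (v : T) : 'cV[R]_n.+1 := \col_j (v j)%:R.
have Xlt v j : 0 <= X v j 0 < (W * Q)%:R by rewrite mxE ler0n ltr_nat ltn_ord.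
(* Shifted to be nonnegative and scaled so that unit intervals are slabs of width [W / Q ^+ n] for
   [m]; there are [M] of them. *)
pose t v : R := ((m *m X v) 0 0 + (A * (W * Q))%:R) * Q%:R ^+ n / W%:R.
pose M := (2 * A * Q ^ n.+1)%N.
have t_itv v : 0 <= t v < M%:R.
  have mX : `|(m *m X v) 0 0| < A%:R * (W * Q)%:R.
    apply: (@le_lt_trans _ _ (S * (W * Q)%:R)).
      rewrite mxE mulr_suml; apply: le_trans (ler_norm_sum _ _ _) _.
      apply: ler_sum => j _; have /andP[x0 x1] := Xlt v j.
      by rewrite normrM ler_wpM2l // ger0_norm // ltW.
    by rewrite ltr_pM2r // ltr0n muln_gt0.
  move: mX; rewrite ltr_norml => /andP[mX1 mX2]; apply/andP; split.
    rewrite /t divr_ge0 ?ler0n // mulr_ge0 ?exprn_ge0 ?ler0n // natrM.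
    by rewrite -lerBlDr sub0r ltW.
  rewrite /t ltr_pdivrMr //.
  have -> : M%:R * W%:R = (A%:R * (W * Q)%:R + A%:R * (W * Q)%:R) * Q%:R ^+ n :> R.
    by rewrite /M !natrM natrX exprS; ring.
  by rewrite ltr_pM2r // natrM ltrD2r.
have t0 v : 0 <= t v by have /andP[] := t_itv v.
have bin_lt v : (Num.truncn (t v) < M)%N.
  by rewrite truncn_lt_nat //; have /andP[] := t_itv v.
pose bin v := Ordinal (bin_lt v).
(* In direction [p] the position inside the slab replaces the coordinate; within one slab,
   differences of [y] are scaled coordinates of differences of points. *)
pose y v q := if q == p then W%:R * (t v - (Num.truncn (t v))%:R) else X v q 0 / Q%:R.
have y_itv v q : 0 <= y v q < W%:R.
  rewrite /y; case: ifP => _.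
    have /andP[t1 t2] := truncn_itv (t0 v).
    rewrite mulr_ge0 ?subr_ge0 ?ler0n //=.
    by rewrite -[ltRHS]mulr1 ltr_pM2l // ltrBlDr addrC natr1.
  have /andP[x0 x1] := Xlt v q; rewrite divr_ge0 ?ler0n //=.
  by rewrite ltr_pdivrMr // -natrM.
have y_diff v v' q : bin v = bin v' ->
    y v q - y v' q = scaled_coord m p Q (X v - X v') q.
  move=> /(congr1 val) /= vv'; rewrite /y /scaled_coord; case: ifP => _; last first.
    by rewrite [(X v - X v') q 0]mxE [(- X v') q 0]mxE mulrBl.
  rewrite vv' mulmxBr [(m *m X v - _) 0 0]mxE [(- (m *m X v')) 0 0]mxE /t; field.
  by rewrite gt_eqF.
have y_dist v v' q : bin v = bin v' -> `|scaled_coord m p Q (X v - X v') q| <= W%:R.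
  move=> vv'; rewrite -y_diff //.
  have /andP[a1 a2] := y_itv v q; have /andP[b1 b2] := y_itv v' q.
  by rewrite ler_norml; apply/andP; split; lra.
(* Pairs not both in the slab [beta] get the zero vector, which meets the bounds and lies on every
   hyperplane. *)
pose w (beta : 'I_M) (vv : T * T) : 'rV[R]_n.+1 :=
  if (bin vv.1 == beta) && (bin vv.2 == beta) then (X vv.1 - X vv.2)^T else 0.
have hyper beta : exists h : 'cV[R]_n.+1, h != 0 /\ forall vv, w beta vv *m h = 0.
  have [[s us]|[h h0 hw]] := spanning_subfamily_or_hyperplane (w beta); last by exists h.
  case: nob.
  pose b : 'M[int]_n.+1 := \matrix_(j, k)
    if (bin (s k).1 == beta) && (bin (s k).2 == beta)
    then ((s k).1 j)%:Z - ((s k).2 j)%:Z else 0.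
  have bE : map_mx intr b = (\matrix_i w beta (s i))^T :> 'M[R]_n.+1.
    apply/matrixP => j k; rewrite !mxE /w; case: ifP => _; last by rewrite mxE.
    by rewrite rmorphB /= !mxE.
  have mb k : (m *m map_mx intr b) 0 k = (m *m (w beta (s k))^T) 0 0.
    by rewrite bE !mxE; apply: eq_bigr => j _; rewrite !mxE.
  exists b; split; first by rewrite bE unitmx_tr.
    move=> k; rewrite mb /w; case: ifP => [/andP[/eqP b1 /eqP b2]|_]; last first.
      by rewrite trmx0 mulmx0 mxE normr0 divr_ge0 // ltW.
    have := y_dist (s k).1 (s k).2 p; rewrite b1 b2 => /(_ erefl).
    rewrite /scaled_coord eqxx normrM (ger0_norm (ltW Qn)) trmxK => le_W.
    by rewrite ler_pdivlMr // mulrC.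
  move=> j k; rewrite mxE; case: ifP => _; last by rewrite rmorph0 normr0 mulr_ge0 // ltW.
  have /andP[a1 a2] := Xlt (s k).1 j; have /andP[b1 b2] := Xlt (s k).2 j.
  move: a1 a2 b1 b2; rewrite rmorphB /= !mxE -natrM => a1 a2 b1 b2.
  by rewrite ler_norml; apply/andP; split; lra.
have [h hP] := choice hyper.
have [q0 q0P] := choice (fun beta => scaled_coord_hyperplane Q0 mp (hP beta).1).
have sub_lt v q : (Num.truncn (y v q / e) < W * D)%N.
  have /andP[y0 y1] := y_itv v q.
  rewrite truncn_lt_nat ?(divr_ge0 y0 (ltW e0)) // (natrM _ W).
  apply: (@lt_trans _ _ (W%:R * e^-1)); first by rewrite ltr_pM2r ?invr_gt0.
  by rewrite ltr_pM2l.
(* The coordinate [q0] of the slab is left out; the other [n] are cut into intervals of length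
   [e]. *)
pose sub v : {ffun 'I_n -> 'I_(W * D)} :=
  [ffun j => Ordinal (sub_lt v (lift (q0 (bin v)) j))].
(* Two points with equal slab and cell differ by a vector of the slab's hyperplane, small in all
   scaled coordinates but [q0], hence in all; the separation hypothesis makes it zero. *)
have inj : injective (fun v => (bin v, sub v)).
  move=> v v' E; have Eb : bin v = bin v' := congr1 fst E.
  have Es : sub v = sub v' := congr1 snd E.
  have close q : q != q0 (bin v) -> `|scaled_coord m p Q (X v - X v') q| <= e.
    rewrite eq_sym => /unlift_some[j -> _]; rewrite -y_diff //.
    move/ffunP/(_ j): Es; rewrite !ffunE Eb => /(congr1 val) /= Es.
    have /andP[a1 _] := y_itv v (lift (q0 (bin v')) j).
    have /andP[b1 _] := y_itv v' (lift (q0 (bin v')) j).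
    have := truncn_eq_dist (divr_ge0 a1 (ltW e0)) (divr_ge0 b1 (ltW e0)) Es.
    by rewrite -mulrBl normrM normfV (gtr0_norm e0) ler_pdivrMr // mul1r.
  have hv : (X v - X v')^T *m h (bin v) = 0.
    by have := (hP (bin v)).2 (v, v'); rewrite /w /= -Eb eqxx.
  have all_close := q0P _ _ _ (ltW e0) hv close.
  have ne0 : 0 <= n.+1%:R * e by rewrite mulr_ge0 ?ler0n // ltW.
  have [mle xle] := scaled_coord_bound Q0 mp ne0 all_close.
  pose d : 'cV[int]_n.+1 := \col_j ((v j)%:Z - (v' j)%:Z).
  have dE : map_mx intr d = X v - X v'.
    by apply/colP => j; rewrite !mxE rmorphB.
  have d00 : d = 0.
    apply: sep.
      rewrite dE; apply: le_trans mle _; rewrite ler_pM2r ?invr_gt0 // -eK.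
      by rewrite ler_peMl.
    move=> j; have := xle j; rewrite -dE mxE -/S -/K eK; exact: id.
  apply/ffunP => j; apply: val_inj; move/colP/(_ j): d00; rewrite !mxE => /eqP.
  by rewrite subr_eq0 => /eqP [].
(* The target has [(W - 1) * W ^ n * Q ^ n.+1] elements, fewer than the [(W * Q) ^ n.+1] points. *)
have := leq_card _ inj.
rewrite card_ffun card_prod card_ffun !card_ord.
rewrite leqNgt => /negP[].
have -> : (M * (W * D) ^ n = (2 * A * D ^ n) * (W ^ n * Q ^ n.+1))%N.
  by rewrite /M expnMn; lia.
have -> : ((W * Q) ^ n.+1 = W * (W ^ n * Q ^ n.+1))%N.
  by rewrite expnMn expnS; lia.
by rewrite ltn_pmul2r ?muln_gt0 ?expn_gt0 ?Q0.
Qed.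

(** * Comparison of the adapted bases *)

Lemma infinite_pigeonhole (T : finType) (P : nat -> Prop) (c : nat -> T) :
  (forall N, exists2 k, (N <= k)%N & P k) ->
  exists t, forall N, exists2 k, (N <= k)%N & P k /\ c k = t.
Proof.
move=> infP; apply: contrapT => /forallNP no.
have ex t : exists N, forall k, (N <= k)%N -> P k -> c k <> t.
  have /existsNP[N HN] := no t; exists N => k Nk Pk ck; apply: HN.
  by exists k.
have [N NP] := choice ex.
have [k Nk Pk] := infP (\max_t N t).
by apply: (NP (c k) k) => //; apply: leq_trans Nk; apply: leq_bigmax.
Qed.

Lemma prod_lower_bound (R : realFieldType) (n : nat) (a X : 'I_n -> R) (c : R) i :
  (forall j, 0 <= a j <= X j) -> c <= \prod_j a j -> c * X i <= a i * \prod_j X j.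
Proof.
move=> aX ca; have /andP[ai Xi] := aX i.
apply: (@le_trans _ _ ((\prod_j a j) * X i)).
  by rewrite ler_wpM2r // (le_trans ai).
rewrite (bigD1 i) //= [in leRHS](bigD1 i) //= -!mulrA ler_wpM2l //.
rewrite mulrC ler_wpM2l ?(le_trans ai) //.
by apply: ler_prod => j _; apply: aX.
Qed.

(** The modulus with values in [R]; [|z|] itself lies in [R[i]]. *)
Definition cnorm (R : rcfType) (z : R[i]) : R := complex.Re `|z|.

Lemma cnormE (R : rcfType) (z : R[i]) : `|z| = real_complex R (cnorm z).
Proof. by rewrite RRe_real ?normr_real. Qed.

Lemma cnorm_ge0 (R : rcfType) (z : R[i]) : 0 <= cnorm z.
Proof. by rewrite -ler0c -cnormE. Qed.

Lemma cnorm_eq0 (R : rcfType) (z : R[i]) : (cnorm z == 0) = (z == 0).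
Proof. by rewrite -[RHS]normr_eq0 cnormE (fmorph_eq0 (real_complex R)). Qed.

Lemma cnormM (R : rcfType) (z w : R[i]) : cnorm (z * w) = cnorm z * cnorm w.
Proof. by apply: (@complexI R); rewrite rmorphM /= -!cnormE normrM. Qed.

Lemma cnorm_prod (R : rcfType) (n : nat) (z : 'I_n -> R[i]) :
  cnorm (\prod_i z i) = \prod_i cnorm (z i).
Proof.
elim/big_ind2: _ => [|x x' y y' <- <-|//]; last exact: cnormM.
by apply: (@complexI R); rewrite -cnormE normr1.
Qed.

Lemma cnorm_sum (R : rcfType) (n : nat) (z : 'I_n -> R[i]) :
  cnorm (\sum_i z i) <= \sum_i cnorm (z i).
Proof.
rewrite -lecR rmorph_sum /=.
have := ler_norm_sum (index_enum 'I_n) z xpredT.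
by rewrite cnormE (eq_bigr _ (fun i _ => cnormE (z i))).
Qed.

Lemma cnorm_real (R : rcfType) (x : R) : cnorm (real_complex R x) = `|x|.
Proof.
by rewrite /cnorm normc_def /= expr0n /= addr0 sqrtr_sqr.
Qed.

Lemma cnorm_int (R : rcfType) (m : int) : cnorm (m%:~R : R[i]) = `|m%:~R|.
Proof. by rewrite -(rmorph_int (real_complex R)) /= cnorm_real. Qed.

(* Size, up to a constant, of the forms [l_i] on the vectors of a basis adapted
   to [Q], where [l_i0] is the real form made small. *)
Definition place_weight (R : fieldType) (n : nat) (i0 : 'I_n.+1) (Q : nat) i : R :=
  if i == i0 then (Q%:R ^+ n)^-1 else Q%:R.

Lemma prod_place_weight (R : numFieldType) (n : nat) (i0 : 'I_n.+1) (Q : nat) :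
  (0 < Q)%N -> \prod_i place_weight R i0 Q i = 1.
Proof.
move=> Q0; rewrite (bigD1 i0) //= /place_weight eqxx.
rewrite (eq_bigr (fun=> Q%:R)) => [|i /negPf-> //].
rewrite prodr_const (_ : #|_| = n) ?mulVf //.
  by rewrite expf_neq0 // pnatr_eq0 -lt0n.
by have := cardC1 i0; rewrite card_ord.
Qed.

Lemma linear_forms_weight_bound (R : realType) (n : nat) (L : 'M[R[i]]_n.+1)
    (i0 : 'I_n.+1) (m : 'rV[R]_n.+1) (c : R[i]) :
  c != 0 -> c *: row i0 L = map_mx (real_complex R) m ->
  exists2 C : R, 0 < C & forall (Q : nat) (e : R) (v : 'cV[int]_n.+1), 0 <= e ->
    `|(m *m map_mx intr v) 0 0| <= e / Q%:R ^+ n ->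
    (forall j, `|(v j 0)%:~R : R| <= e * Q%:R) ->
    forall i, cnorm ((L *m map_mx intr v) i 0) <= C * e * place_weight R i0 Q i.
Proof.
move=> c0 cm; pose S := \sum_i \sum_j cnorm (L i j).
have S0 : 0 <= S by apply: sumr_ge0 => i _; apply: sumr_ge0 => j _; apply: cnorm_ge0.
have nc0 : 0 < cnorm c by rewrite lt_neqAle cnorm_ge0 eq_sym cnorm_eq0 c0.
exists (S + (cnorm c)^-1) => [|Q e v e0 mv ve i].
  by rewrite ltr_wpDl ?invr_gt0.
rewrite /place_weight; case: eqP => [->|_].
  have -> : cnorm ((L *m map_mx intr v) i0 0) = (cnorm c)^-1 * `|(m *m map_mx intr v) 0 0|.
    apply: (mulfI (lt0r_neq0 nc0)); rewrite mulrA mulfV ?gt_eqF // mul1r -cnormM -cnorm_real.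
    congr cnorm; have -> : (L *m map_mx intr v) i0 0 = (row i0 L *m map_mx intr v) 0 0.
      by rewrite -row_mul [RHS]mxE.
    have -> : c * (row i0 L *m map_mx intr v) 0 0 = ((c *: row i0 L) *m map_mx intr v) 0 0.
      by rewrite -scalemxAl [RHS]mxE.
    rewrite cm !mxE rmorph_sum; apply: eq_bigr => j _.
    by rewrite !mxE rmorphM /= rmorph_int.
  rewrite mulrDl mulrDl ler_wpDl ?mulr_ge0 ?invr_ge0 ?exprn_ge0 ?ler0n //.
  by rewrite -mulrA ler_wpM2l // invr_ge0 ltW.
have eQ0 : 0 <= e * Q%:R by rewrite mulr_ge0 ?ler0n.
apply: (@le_trans _ _ (S * (e * Q%:R))); last first.
  by rewrite -mulrA ler_wpM2r // lerDl invr_ge0 ltW.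
rewrite mxE; apply: le_trans (cnorm_sum _) _.
apply: (@le_trans _ _ (\sum_j cnorm (L i j) * (e * Q%:R))).
  by apply: ler_sum => j _; rewrite cnormM mxE cnorm_int ler_wpM2l ?cnorm_ge0.
rewrite -mulr_suml ler_wpM2r // /S [leRHS](bigD1 i) //= lerDl.
by apply: sumr_ge0 => k _; apply: sumr_ge0 => j _; apply: cnorm_ge0.
Qed.

Lemma unitmx_intr (F : numFieldType) (n : nat) (b : 'M[int]_n) :
  ((map_mx intr b : 'M[F]_n) \in unitmx) = (\det b != 0).
Proof. by rewrite unitmxE unitfE det_map_mx intr_eq0. Qed.

Lemma col_mulmx (F : comNzRingType) (m n p : nat) (A : 'M[F]_(m, n)) (B : 'M[F]_(n, p)) j :
  col j (A *m B) = A *m col j B.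
Proof. by rewrite !colE mulmxA. Qed.

Lemma int_value_norm (R : realType) (n : nat) (f : {mpoly R[n]})
    (L : 'M[R[i]]_n) (w : 'cV[int]_n) :
  factors_as f L ->
  `|f.@[fun j => (w j 0)%:~R]| = \prod_i cnorm ((L *m map_mx intr w) i 0).
Proof. by move=> fL; rewrite -cnorm_real (int_value_factors _ fL) cnorm_prod. Qed.

(** The separation required by [small_value_basis] comes from the lower bound on [f]: the weights
    multiply to 1, so on a nonzero vector that is too small the product of the forms would drop
    below [c0]. *)
Lemma adapted_bases (R : realType) (n : nat) (f : {mpoly R[n.+1]})
    (L : 'M[R[i]]_n.+1) (i0 : 'I_n.+1) (c0 : R) :
  factors_as f L -> real_up_to_scaling (row i0 L) -> 0 < c0 ->
  (forall w : 'cV[int]_n.+1, w != 0 -> c0 <= `|f.@[fun j => (w j 0)%:~R]|) ->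
  exists2 Y : R, 0 < Y & exists b : nat -> 'M[int]_n.+1, forall k,
    \det (b k) != 0 /\
    forall i j, cnorm ((L *m map_mx intr (b k)) i j) <= Y * place_weight R i0 k.+1 i.
Proof.
move=> fL [c cn0 [m cm]] c00 low.
have uL : L \in unitmx by rewrite -row_free_unit; case: fL.
have m0 : m != 0.
  apply: contraNneq (oner_neq0 R[i]) => m0; rewrite m0 map_mx0 in cm.
  have /eqP : row i0 (L *m invmx L) 0 i0 = 0.
    have -> : L *m invmx L = c^-1 *: (c *: L) *m invmx L by rewrite scalerA mulVf ?scale1r.
    have -> : row i0 (c^-1 *: (c *: L) *m invmx L) = (c^-1 *: (c *: row i0 L)) *m invmx L.
      by rewrite row_mul; congr (_ *m _); apply/rowP => j; rewrite !mxE.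
    by rewrite cm scaler0 mul0mx mxE.
  by rewrite mulmxV // !mxE eqxx.
have [C C0 CP] := linear_forms_weight_bound cn0 cm.
(* Ensures [eta ^+ n.+1 <= eta < c0]. *)
pose eta := Num.min 1 (c0 / 2).
have eta0 : 0 < eta by rewrite lt_min ltr01 divr_gt0.
have [B B0 BP] := small_value_basis m0 (divr_gt0 eta0 C0).
have sep Q : (0 < Q)%N -> forall v : 'cV[int]_n.+1,
    `|(m *m map_mx intr v) 0 0| <= (eta / C) / Q%:R ^+ n ->
    (forall j, `|(v j 0)%:~R : R| <= (eta / C) * Q%:R) -> v = 0.
  move=> Q0 v mv vj; apply/eqP; apply: contraT => /low.
  rewrite leNgt => /negP[]; rewrite (int_value_norm _ fL).
  apply: (@le_lt_trans _ _ (\prod_i (eta * place_weight R i0 Q i))).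
    apply: ler_prod => i _; rewrite cnorm_ge0 /=.
    have := CP Q _ v (ltW (divr_gt0 eta0 C0)) mv vj i.
    by rewrite mulrCA divff ?mulr1 // gt_eqF.
  rewrite big_split /= prod_place_weight // mulr1 prodr_const card_ord exprS.
  apply: (@le_lt_trans _ _ eta).
    by rewrite ler_piMr ?(ltW eta0) // exprn_ile1 ?(ltW eta0) // ge_min lexx.
  by rewrite gt_min; apply/orP; right; lra.
have [b bP] := choice (fun k => BP k.+1 (ltn0Sn k) (sep k.+1 (ltn0Sn k))).
exists (C * B); first exact: mulr_gt0.
exists b => k; have [ub mb bj] := bP k; split; first by rewrite -(unitmx_intr R).
move=> i j; have colE' (A : 'M[R[i]]_n.+1) : A i j = (col j A) i 0 by rewrite mxE.
rewrite colE' col_mulmx -map_col; apply: CP; first exact: ltW.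
  by rewrite map_col -col_mulmx [col j _ _ _]mxE; apply: mb.
by move=> q; rewrite mxE; apply: bj.
Qed.

Lemma finite_colouring (T : eqType) (X : finType) (A : set T) (v : nat -> X -> T) :
  finite_set A -> (forall k x, A (v k x)) ->
  exists (U : finType) (c : nat -> U), forall k l, c k = c l -> v k =1 v l.
Proof.
move=> /finite_seqP[s ->] vs.
exists {ffun X -> 'I_(size s).+1}, (fun k => [ffun x => inord (index (v k x) s)]).
move=> k l /ffunP E x; have := E x; rewrite !ffunE => /(congr1 val) /=.
have sv q : v q x \in s by apply: vs.
rewrite !inordK ?ltnS ?index_size // => ind.
by rewrite -(nth_index (v k x) (sv k)) ind nth_index.
Qed.

(** A first pigeonhole fixes the table of values of [f] on the grid in the basis [b k]. Equal tables
    give the same forms up to scalars and a permutation relative to [b k0], and a second pigeonhole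
    fixes the permutation. *)
Lemma proportional_bases (R : realType) (n : nat) (f : {mpoly R[n.+1]})
    (L : 'M[R[i]]_n.+1) (i0 : 'I_n.+1) (Y : R) (b : nat -> 'M[int]_n.+1) :
  factors_as f L ->
  (forall M : R, finite_set
     [set y | `|y| <= M /\ exists w : 'cV[int]_n.+1, y = f.@[fun j => (w j 0)%:~R]]%classic) ->
  0 < Y -> (forall k, \det (b k) != 0 /\
    forall i j, cnorm ((L *m map_mx intr (b k)) i j) <= Y * place_weight R i0 k.+1 i) ->
  exists k, forall N, exists2 l, (N <= l)%N &
    exists lam : 'I_n.+1 -> R[i], forall i,
      row i (L *m map_mx intr (b l)) = lam i *: row i (L *m map_mx intr (b k)).
Proof.
move=> fL fin Y0 bP; have uL : L \in unitmx by rewrite -row_free_unit; case: fL.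
pose G := {ffun 'I_n.+1 -> 'I_n.+2}.
pose vec (x : G) : 'cV[int]_n.+1 := \col_j (x j)%:Z.
pose val k x := f.@[fun j => ((b k *m vec x) j 0)%:~R].
(* [n.+1] terms, grid coordinates below [n.+2], entries at most [Y] times the weight; the weights
   cancel in the product over [i]. *)
pose K : R := n.+1%:R * n.+2%:R * Y.
have K0 : 0 <= K by rewrite !mulr_ge0 ?ler0n // ltW.
have valM k x : `|val k x| <= K ^+ n.+1.
  have -> : K ^+ n.+1 = \prod_i (K * place_weight R i0 k.+1 i).
    by rewrite big_split /= prod_place_weight // mulr1 prodr_const card_ord.
  rewrite /val (int_value_norm _ fL); apply: ler_prod => i _; rewrite cnorm_ge0 /=.
  rewrite map_mxM mulmxA mxE; apply: le_trans (cnorm_sum _) _.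
  apply: (@le_trans _ _ (\sum_(j < n.+1) n.+2%:R * (Y * place_weight R i0 k.+1 i))).
    apply: ler_sum => j _; rewrite cnormM mulrC ler_pM ?cnorm_ge0 //; last first.
      by have [_] := bP k; apply.
    by rewrite !mxE cnorm_int ger0_norm ?ler0n // ler_nat ltnW.
  by rewrite sumr_const card_ord -[_ *+ n.+1]mulr_natl /K !mulrA.
have [|U [c cP]] := finite_colouring (v := val) (fin (K ^+ n.+1)).
  by move=> k x; split; [exact: valM | exists (b k *m vec x)].
have [N|t tP] := @infinite_pigeonhole U (fun=> True) c; first by exists N.
have [k0 _ [_ ck0]] := tP 0.
have ub k : L *m map_mx intr (b k) \in unitmx.
  by rewrite unitmx_mul uL unitmx_intr; case: (bP k).
(* Off the colour [t] the identity is only a default value. *)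
have perm k : exists p : {ffun 'I_n.+1 -> 'I_n.+1}, c k = t ->
    forall i, exists2 mu, mu != 0 &
      row i (L *m map_mx intr (b k)) = mu *: row (p i) (L *m map_mx intr (b k0)).
  have [ck|] := pselect (c k = t); last by exists [ffun i => i].
  suff /choice[p pP] : forall i, exists j, exists2 mu, mu != 0 &
      row i (L *m map_mx intr (b k)) = mu *: row j (L *m map_mx intr (b k0)).
    by exists (finfun p) => _ i; rewrite ffunE.
  apply: eq_prod_linear_forms => //; apply: eq_prod_linear_forms_grid => x.
  have -> : \col_j (x j)%:R = map_mx intr (vec x) :> 'cV[R[i]]_n.+1.
    by apply/colP => j; rewrite !mxE.
  rewrite -!mulmxA -!map_mxM -!(int_value_factors _ fL).
  by congr (real_complex R _); apply: (cP k k0); rewrite ck ck0.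
have [p pP] := choice perm.
have [|q qP] := @infinite_pigeonhole _ (fun k => c k = t) p.
  by move=> N; have [k Nk [_ ck]] := tP N; exists k.
(* Since [b k] and [b l] share colour and permutation, comparing both with [b k0] makes rows of
   equal index proportional. *)
have [k _ [ck pk]] := qP 0; exists k => N; have [l Nl [cl pl]] := qP N.
have ratio i : exists la : R[i],
    row i (L *m map_mx intr (b l)) = la *: row i (L *m map_mx intr (b k)).
  have [mu mu0 E] := pP k ck i; have [mu' _ E'] := pP l cl i.
  by exists (mu' / mu); rewrite E E' pk pl scalerA divfK.
by have [lam lamP] := choice ratio; exists l => //; exists lam.
Qed.

(** * Eigenvalues *)

(** Here [la] is the common modulus of two eigenvalues: the last two inequalities bound it above by
    [(P / c) * (q1 / q2) ^+ n.+1] and below by [(c / P) * (q2 / q1)]. Together,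
    [(q2 / q1) ^+ n.+2 <= (P / c) ^+ 2], against the choice of [N]. *)
Lemma growth_contradiction (R : realFieldType) (n : nat) (la c P q1 q2 N : R) :
  0 < c -> 0 < P -> 0 < q1 -> 1 <= N -> N * q1 <= q2 -> (P / c) ^+ 2 < N ->
  la * c * q2 ^+ n.+1 <= P * q1 ^+ n.+1 -> c * q2 <= la * q1 * P -> False.
Proof.
move=> c0 P0 q10 N1 Nq NP le1 le2.
have N0 : 0 <= N by apply: le_trans N1.
have q20 : 0 < q2 by apply: lt_le_trans Nq; rewrite mulr_gt0 // (lt_le_trans ltr01).
have : N * q1 ^+ n.+2 <= (P / c) ^+ 2 * q1 ^+ n.+2.
  apply: (@le_trans _ _ (q2 ^+ n.+2)).
    apply: (@le_trans _ _ ((N * q1) ^+ n.+2)).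
      by rewrite exprMn ler_wpM2r ?(exprn_ge0 _ (ltW q10)) // exprS ler_peMr // exprn_ege1.
    by rewrite lerXn2r // nnegrE ?mulr_ge0 ?(ltW q10) ?(ltW q20).
  have -> : (P / c) ^+ 2 * q1 ^+ n.+2 = P * q1 * (P * q1 ^+ n.+1) / c ^+ 2.
    by rewrite (exprS q1 n.+1); field; rewrite gt_eqF.
  rewrite ler_pdivlMr ?exprn_gt0 //.
  apply: (@le_trans _ _ (P * q1 * (la * c * q2 ^+ n.+1))); last first.
    by rewrite ler_wpM2l // mulr_ge0 ?(ltW P0) ?(ltW q10).
  have -> : q2 ^+ n.+2 * c ^+ 2 = c * q2 * (c * q2 ^+ n.+1) by rewrite (exprS q2 n.+1); ring.
  have -> : P * q1 * (la * c * q2 ^+ n.+1) = la * q1 * P * (c * q2 ^+ n.+1) by ring.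
  by rewrite ler_wpM2r // mulr_ge0 ?exprn_ge0 ?(ltW c0) ?(ltW q20).
by rewrite ler_pM2r ?exprn_gt0 // leNgt NP.
Qed.

(** On a basis vector the product of the forms is at least [c0] and the weights multiply to 1, so
    each form is comparable to its weight from both sides. For [l] large against [k], [lam i0] is
    thus small and the other [lam j] are large. *)
Lemma eigenvalue_separation (R : realType) (n : nat) (f : {mpoly R[n.+2]})
    (L : 'M[R[i]]_n.+2) (i0 : 'I_n.+2) (c0 Y : R) (b : nat -> 'M[int]_n.+2) (k : nat) :
  factors_as f L -> 0 < c0 -> 0 < Y ->
  (forall w : 'cV[int]_n.+2, w != 0 -> c0 <= `|f.@[fun j => (w j 0)%:~R]|) ->
  (forall k, \det (b k) != 0 /\
    forall i j, cnorm ((L *m map_mx intr (b k)) i j) <= Y * place_weight R i0 k.+1 i) ->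
  exists N, forall (l : nat) (lam : 'I_n.+2 -> R[i]), (N <= l)%N ->
    (forall i, row i (L *m map_mx intr (b l)) = lam i *: row i (L *m map_mx intr (b k))) ->
    forall j, j != i0 -> lam j != lam i0.
Proof.
move=> fL c00 Y0 low bP; pose P := Y ^+ n.+2.
have P0 : 0 < P by rewrite exprn_gt0.
pose a q i := cnorm ((L *m map_mx intr (b q)) i 0).
have aY q i : a q i <= Y * place_weight R i0 q.+1 i by have [_] := bP q; apply.
have alow q i : c0 * (Y * place_weight R i0 q.+1 i) <= a q i * P.
  have -> : P = \prod_j (Y * place_weight R i0 q.+1 j).
    by rewrite big_split /= prod_place_weight // mulr1 prodr_const card_ord.
  apply: prod_lower_bound => [j|]; first by rewrite cnorm_ge0 aY.
  have w0 : col 0 (b q) != 0.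
    have [db _] := bP q; apply: contraNneq db => w0.
    rewrite (expand_det_col _ 0) big1 // => j _.
    by move/colP/(_ j): w0; rewrite !mxE => ->; rewrite mul0r.
  apply: le_trans (low _ w0) _; rewrite (int_value_norm _ fL).
  rewrite le_eqVlt; apply/orP; left; apply/eqP; apply: eq_bigr => i' _.
  by rewrite /a map_col -col_mulmx [in LHS]mxE.
(* Past [N * k.+1], the ratio of [l.+1] to [k.+1] is at least [N], which exceeds [(P / c0) ^+ 2]. *)
pose N := maxn 1 (Num.bound ((P / c0) ^+ 2)).
exists (N * k.+1)%N => l lam Nl lamE j ji0; apply/eqP => lamji.
have aE i : a l i = cnorm (lam i) * a k i.
  by rewrite /a -cnormM; congr cnorm; move/rowP/(_ 0): (lamE i); rewrite !mxE.
have la0 := cnorm_ge0 (lam i0).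
apply: (@growth_contradiction R n (cnorm (lam i0)) c0 P k.+1%:R l.+1%:R N%:R) => //.
- by rewrite ler1n leq_maxl.
- by rewrite -natrM ler_nat leqW.
- apply: lt_le_trans (archi_boundP _) _; first by rewrite exprn_ge0 // divr_ge0 // ltW.
  by rewrite ler_nat leq_maxr.
- have le1 : cnorm (lam i0) * (c0 * (Y * place_weight R i0 k.+1 i0)) <=
             Y * place_weight R i0 l.+1 i0 * P.
    apply: (@le_trans _ _ (a l i0 * P)); last by rewrite ler_wpM2r ?aY // ltW.
    by rewrite aE -(mulrA (cnorm (lam i0))); exact: ler_wpM2l (alow k i0).
  have kp : 0 < k.+1%:R ^+ n.+1 :> R by rewrite exprn_gt0 // ltr0n.
  have lp : 0 < l.+1%:R ^+ n.+1 :> R by rewrite exprn_gt0 // ltr0n.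
  move: le1; rewrite /place_weight eqxx.
  have -> : cnorm (lam i0) * (c0 * (Y * (k.+1%:R ^+ n.+1)^-1)) =
            Y * (cnorm (lam i0) * c0 / k.+1%:R ^+ n.+1) by ring.
  have -> : Y * (l.+1%:R ^+ n.+1)^-1 * P = Y * (P / l.+1%:R ^+ n.+1) by ring.
  by rewrite ler_pM2l // ler_pdivrMr // mulrAC ler_pdivlMr.
- have := alow l j; rewrite aE lamji /place_weight (negPf ji0) => le2.
  have le3 : cnorm (lam i0) * a k j * P <= cnorm (lam i0) * (Y * k.+1%:R) * P.
    rewrite ler_wpM2r ?(ltW P0) // ler_wpM2l //; have := aY k j.
    by rewrite /place_weight (negPf ji0).
  rewrite -(ler_pM2l Y0); apply: le_trans (le_trans _ (le_trans le2 le3)) _.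
    by rewrite mulrCA.
  by rewrite le_eqVlt; apply/orP; left; apply/eqP; ring.
Qed.

Lemma norm_form_of_lattice_values (R : realType) (n : nat) (f : {mpoly R[n.+2]})
    (L : 'M[R[i]]_n.+2) (i0 : 'I_n.+2) (c0 : R) :
  factors_as f L -> real_up_to_scaling (row i0 L) -> ~ represents_zero_over_Q f ->
  0 < c0 ->
  (forall w : 'cV[int]_n.+2, w != 0 -> c0 <= `|f.@[fun j => (w j 0)%:~R]|) ->
  (forall M : R, finite_set
     [set y | `|y| <= M /\ exists w : 'cV[int]_n.+2, y = f.@[fun j => (w j 0)%:~R]]%classic) ->
  norm_form f.
Proof.
move=> fL rL nz c00 low fin.
have [Y Y0 [b bP]] := adapted_bases fL rL c00 low.
have [k kP] := proportional_bases fL fin Y0 bP.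
have [N NP] := eigenvalue_separation k fL c00 Y0 low bP.
have [l Nl [lam lamE]] := kP N.
pose Bk : 'M[rat]_n.+2 := map_mx intr (b k).
pose Bl : 'M[rat]_n.+2 := map_mx intr (b l).
have uk : Bk \in unitmx by rewrite unitmx_intr; case: (bP k).
have toC (A : 'M[int]_n.+2) :
    map_mx ratr (map_mx intr A : 'M[rat]_n.+2) = map_mx intr A :> 'M[R[i]]_n.+2.
  by apply/matrixP => i j; rewrite !mxE ratr_int.
apply: (@norm_form_of_eigenbasis R n.+1 f L (Bl *m invmx Bk) lam i0) => //; last exact: NP lamE.
split=> [|w w0 i|i].
- by rewrite -row_free_unit; case: fL.
- have fw : f.@[fun j => (map_mx ratr w : 'cV[R]_n.+2) j 0] != 0.
    apply/eqP => fw; apply: nz; exists w => //; rewrite -fw.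
    by apply: meval_eq => j; rewrite mxE.
  have : real_complex R f.@[fun j => (map_mx ratr w : 'cV[R]_n.+2) j 0] != 0.
    by apply: contraNneq fw => /complexI ->.
  rewrite (meval_factors_as _ fL) => /prodf_neq0/(_ i isT).
  have -> // : map_mx (real_complex R) (map_mx ratr w) = map_mx ratr w.
  by apply/matrixP => j q; rewrite !mxE /= fmorph_rat.
- have ukC : map_mx ratr Bk \in (unitmx : pred 'M[R[i]]_n.+2).
    by rewrite (map_unitmx (ratr : {rmorphism rat -> R[i]})).
  apply: (can_inj (mulmxK ukC)).
  rewrite -mulmxA -map_mxM mulmxKV // -scalemxAl !toC -!row_mul.
  exact: lamE.
Qed.

(** * Complex conjugation *)

(** The involution exchanges the indices with [i < s i] and those with [s i < i]. *)
Lemma fixed_point_free_involution_even (n : nat) (s : 'I_n -> 'I_n) :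
  involutive s -> (forall i, s i != i) -> ~~ odd n.
Proof.
move=> sK s_neq; pose A := [set i : 'I_n | (i < s i)%N].
have AC : ~: A = s @: A.
  apply/setP => i; rewrite !inE -leqNgt; apply/idP/imsetP => [si|[j]].
    exists (s i); rewrite ?sK // inE sK ltn_neqAle si andbT.
    exact: s_neq.
  by rewrite inE => /ltnW js ->; rewrite sK.
have := cardsC A; rewrite AC card_imset; last exact: can_inj sK.
by rewrite card_ord addnn => <-; rewrite odd_double.
Qed.

Lemma row_proportional (F : fieldType) (n : nat) (L : 'M[F]_n) (a : F) i j :
  L \in unitmx -> row i L = a *: row j L -> i = j.
Proof.
move=> uL /(congr1 (fun v => v *m invmx L)).
rewrite -scalemxAl -!row_mul mulmxV // => /rowP/(_ i); rewrite !mxE eqxx.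
by case: eqVneq => [-> //|_] /eqP; rewrite mulr0 oner_eq0.
Qed.

(** At real points [f] is real, so the forms and their conjugates have the same product; uniqueness
    of the factorization matches them. *)
Lemma conj_factors (R : realType) (n : nat) (f : {mpoly R[n]}) (L : 'M[R[i]]_n) :
  factors_as f L -> forall i, exists j, exists2 c, c != 0 &
    row i (map_mx conjc L) = c *: row j L.
Proof.
move=> fL; have uL : L \in unitmx by rewrite -row_free_unit; case: fL.
apply: eq_prod_linear_forms => //; apply: eq_prod_linear_forms_grid => x.
pose y : 'cV[R]_n := \col_j (x j)%:R.
have -> : \col_j (x j)%:R = map_mx (real_complex R) y.
  by apply/colP => j; rewrite !mxE rmorph_nat.
rewrite -(meval_factors_as y fL) -[RHS]conjc_real (meval_factors_as y fL) rmorph_prod.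
apply: eq_bigr => i _; rewrite !mxE rmorph_sum; apply: eq_bigr => j _.
by rewrite rmorphM /= !mxE conjc_real.
Qed.

(** The scalar is the conjugate of a nonzero coefficient [l 0 a]: [conjc (l 0 a) * l 0 j] is its own
    conjugate, as both coefficients are conjugated by the same factor [c]. *)
Lemma real_of_conj_proportional (R : realType) (n : nat) (l : 'rV[R[i]]_n) (c : R[i]) :
  l != 0 -> map_mx conjc l = c *: l -> real_up_to_scaling l.
Proof.
case/rV0Pn => a la lc.
have conjl j : conjc (l 0 j) = c * l 0 j by move/rowP/(_ j): lc; rewrite !mxE.
exists (conjc (l 0 a)); first by rewrite conjc_eq0.
exists (\row_j complex.Re (conjc (l 0 a) * l 0 j)); apply/rowP => j; rewrite !mxE.
set z := _ * _; have : conjc z = z.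
  by rewrite /z rmorphM /= conjcK !conjl; ring.
case: z => u v [] /eqP; rewrite eq_sym -subr_eq0 opprK -mulr2n mulrn_eq0 /=.
by move=> /eqP ->.
Qed.

(** Conjugation permutes the factors, up to scalars, by an involution; a fixed point would be a
    factor that is real up to scaling. *)
Lemma odd_not_totally_imaginary (R : realType) (n : nat) (f : {mpoly R[n]}) :
  odd n -> ~ totally_imaginary f.
Proof.
move=> oddn [L fL t0].
have uL : L \in unitmx by rewrite -row_free_unit; case: fL.
have [s sP] := choice (conj_factors fL).
have conj_row i : exists2 c, c != 0 & map_mx conjc (row i L) = c *: row (s i) L.
  by have [c c0 E] := sP i; exists c; rewrite // map_row.
have sK : involutive s.
  move=> i; have [c c0 E] := conj_row i; have [d d0 E'] := conj_row (s i).
  apply/esym/(row_proportional uL (a := conjc c * d)).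
  have : map_mx conjc (map_mx conjc (row i L)) = row i L.
    by apply/rowP => j; rewrite !mxE conjcK.
  by move=> <-; rewrite E map_mxZ /= E' scalerA.
suff s_neq i : s i != i by have := fixed_point_free_involution_even sK s_neq; rewrite oddn.
apply/eqP => si; have [c c0 E] := conj_row i; rewrite si in E.
have rowL : row i L != 0.
  apply/eqP => r0; have := congr1 (fun v => v *m invmx L) r0.
  rewrite -row_mul mulmxV // mul0mx => /rowP/(_ i); rewrite !mxE eqxx => /eqP.
  by rewrite oner_eq0.
have := real_of_conj_proportional rowL E.
move: t0; rewrite /num_real_factors => /eqP; rewrite cards_eq0 => /eqP/setP/(_ i).
by rewrite !inE => /asboolP.
Qed.

Theorem corollary1p3 (R : realType) (n : nat) (hn : (2 <= n)%N)
    (f : {mpoly R[n]}) (hf : is_form f) :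
  (forall Z : set 'cV[int]_n,
     (Z !=set0)%classic -> ~ Z 0%R -> SLZ_invariant Z ->
     discrete_in_R (int_values f Z) ->
     ~ represents_zero_over_Q f ->
     ~ totally_imaginary f ->
     norm_form f) /\
  (odd n -> ~ totally_imaginary f).
Proof.
split; last exact: odd_not_totally_imaginary.
case: n hn f hf => [|[|n]] // _ f [_ [L fL]] Z Zn Z0 invZ dZ nz nti.
have [[c c0 low] fin] := values_on_lattice fL Zn Z0 invZ dZ nz.
have /card_gt0P[i0] : (0 < num_real_factors L)%N.
  by rewrite lt0n; apply/eqP => t0; apply: nti; exists L.
rewrite inE => /asboolP rL.
exact: norm_form_of_lattice_values fL rL nz c0 low fin.
Qed.
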